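(* Consider the networked feedback system described in the context and suppose it is mean-square input-output stable. Let the input $\{v(k)\}$ be an independent process, independent of $\{\tau_n\}$, with zero mean and bounded variances $\sigma_v^2(k)$. If $\sigma_v^2(k)\to\sigma_v^2$ as $k\to\infty$, then $\sigma_u^2(k)=\mathbb E\{u^2(k)\}$ converges and $$\lim_{k\to\infty}\sigma_u^2(k)=\frac{\|G(z)\|_2^2}{1-\|\Phi(z)G(z)\|_2^2}\,\sigma_v^2.$$
   Context: Setting: $P$ is a SISO discrete-time LTI plant, strictly proper (relative degree $\ge1$), $K$ a proper SISO LTI controller. Let $\tau\ge0$ be an integer, $\mathcal D=\{0,\dots,\tau\}$, $\{\tau_n\}$ i.i.d. with values in $\mathcal D$, $\Pr\{\tau_n=i\}=p_i$, $\sum_ip_i=1$. With real weights $\alpha_i$ and Kronecker delta $\delta$, the channel maps $u$ to $u_d(k)=\sum_{i=0}^{\tau}\alpha_i\delta(\tau_{k-i}-i)u(k-i)$. Closed loop: plant input $v-u_d$, plant output $y$, $u=Ky$; signals real, system at rest at $k=0$. Mean channel $H(z)=\sum_{i=0}^\tau\alpha_ip_iz^{-i}$. Let $\omega(k,n)=\alpha_{k-n}[\delta(\tau_n-(k-n))-p_{k-n}]$ for $n\le k\le n+\tau$, $0$ otherwise, and $d(k)=\sum_{i=0}^\tau\omega(k,k-i)u(k-i)$. Nominal system $G(z)=P(z)K(z)[1+P(z)K(z)H(z)]^{-1}$; the loop is $u=G(v-d)$. Mean-square input-output stable: $G$ stable (poles in open unit disc) and for every input $v$ that is zero-mean white noise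 with bounded variances and independent of $\{\tau_n\}$, $\mathbb E\{d^2(k)\}$ and $\mathbb E\{u^2(k)\}$ are bounded sequences. $\Phi(z)$ is a minimum-phase polynomial in $z^{-1}$ of degree $\tau$ with real coefficients such that $\Phi(z^{-1})\Phi(z)=\frac12\sum_{i_1,i_2=0}^{\tau}(\alpha_{i_1}z^{i_1}-\alpha_{i_2}z^{i_2})(\alpha_{i_1}z^{-i_1}-\alpha_{i_2}z^{-i_2})p_{i_1}p_{i_2}$. $\|F\|_2^2=\frac1{2\pi}\int_{-\pi}^{\pi}|F(e^{j\theta})|^2d\theta$. *)

(* Defs.v *)
From mathcomp Require Import all_boot all_algebra.
From mathcomp Require Import all_classical all_reals all_analysis.
From mathcomp.real_closed Require Import complex.
Import GRing.Theory Num.Theory numFieldNormedType.Exports.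

Set Implicit Arguments.
Unset Strict Implicit.
Unset Printing Implicit Defensive.

Local Open Scope ring_scope.
Local Open Scope classical_set_scope.
Local Open Scope complex_scope.

(* Transfer functions.  A rational transfer function F(z) is represented by  *)
(* two real polynomials n, dd in the variable w = z^{-1}:                    *)
(*      F(z) = n(z^{-1}) / dd(z^{-1}).                                       *)
(* The plant is P(z) = bP(z^-1)/aP(z^-1), the controller K(z) = bK/aK, with  *)
(* the normalisation aP(0) = aK(0) = 1 (proper, causal); strict properness   *)
(* of P is bP(0) = 0.                                                        *)
Section TransferFunctions.
Variable R : realType.

Definition toC (q : {poly R}) : {poly R[i]} := map_poly (real_complex R) q.

Definition sqnorm (c : R[i]) : R := complex.Re c ^+ 2 + complex.Im c ^+ 2.

(* mean channel H(z) = sum_{i=0}^tau alpha_i p_i z^{-i}, as a polynomial in z^{-1} *)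
Definition Hpoly (tau : nat) (alpha p : nat -> R) : {poly R} :=
  \poly_(i < tau.+1) (alpha i * p i).

(* G = PK / (1 + PKH) = (bP bK) / (aP aK + bP bK H)   (in the variable z^{-1}) *)
Definition G_num (bP bK : {poly R}) : {poly R} := bP * bK.
Definition G_den (tau : nat) (alpha p : nat -> R) (bP aP bK aK : {poly R}) : {poly R} :=
  aP * aK + bP * bK * Hpoly tau alpha p.

(* F = n(z^{-1})/dd(z^{-1}) is stable (all poles in the open unit disc |z| < 1):
   F can be written as n'(z^{-1})/d'(z^{-1}) with d'(w) <> 0 for all |w| <= 1,
   i.e. F has no pole with |z| >= 1 (including z = infinity). *)
Definition stable_tf (n dd : {poly R}) : Prop :=
  exists n' d' : {poly R}, n * d' = n' * dd /\
    forall w : R[i], sqnorm w <= 1 -> (toC d').[w] != 0.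

(* value of F = n/dd at z = e^{j theta}, i.e. of n(w)/dd(w) at w = e^{-j theta} *)
Definition tf_circle (n dd : {poly R}) (theta : R) : R[i] :=
  let w := Complex (cos theta) (- sin theta) in (toC n).[w] / (toC dd).[w].

Definition h2sq (n dd : {poly R}) : R :=
  (2 * pi)^-1 * Rintegral lebesgue_measure `[(- pi)%R, pi]
                            (fun theta => sqnorm (tf_circle n dd theta)).

(* Phi(z) = Phi(z^{-1} as polynomial): minimum-phase polynomial in z^{-1} of
   degree tau with  Phi(z^{-1}) Phi(z) = 1/2 sum_{i1,i2} (...)(...) p_i1 p_i2 *)
Definition spectral_factor (tau : nat) (alpha p : nat -> R) (Phi : {poly R}) : Prop :=
  size Phi = tau.+1 /\
  (forall z : R[i], z != 0 -> 1 < sqnorm z -> (toC Phi).[z^-1] != 0) /\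
  (forall z : R[i], z != 0 ->
     (toC Phi).[z] * (toC Phi).[z^-1] =
     2^-1 * \sum_(i1 < tau.+1) \sum_(i2 < tau.+1)
        (((alpha i1)%:C * z ^+ i1 - (alpha i2)%:C * z ^+ i2) *
         ((alpha i1)%:C * z ^- i1 - (alpha i2)%:C * z ^- i2) *
         (p i1)%:C * (p i2)%:C)).

End TransferFunctions.

(* Closed loop (deterministic, for one realization).  Signals are defined    *)
(* for k >= 0 and the system is at rest at k = 0 (all signals 0 at negative  *)
(* times).  Plant:  y(k) = sum_{i>=1} bP_i e(k-i) - sum_{i>=1} aP_i y(k-i),  *)
(* with plant input e = v - u_d; controller:                                 *)
(*   u(k) = sum_{i>=0} bK_i y(k-i) - sum_{i>=1} aK_i u(k-i);                 *)
(* channel: u_d(k) = sum_{i=0}^tau alpha_i delta(tau_{k-i} - i) u(k-i).      *)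
Section ClosedLoop.
Variable R : realType.
Variables (bP aP bK aK : {poly R}) (tau : nat) (alpha : nat -> R).
Variables (v : nat -> R) (del : nat -> nat).

Definition sig_back (x : seq R) (k i : nat) : R :=
  if (i <= k)%N then nth 0 x (k - i) else 0.

(* h = [(y(0),u(0),e(0)); ...; (y(k-1),u(k-1),e(k-1))]; computes time k *)
Definition loop_step (k : nat) (h : seq (R * R * R)) : R * R * R :=
  let ys := map (fun t => t.1.1) h in
  let us := map (fun t => t.1.2) h in
  let es := map (fun t => t.2) h in
  let yk := \sum_(1 <= i < size bP) bP`_i * sig_back es k i
            - \sum_(1 <= i < size aP) aP`_i * sig_back ys k i in
  let uk := bK`_0 * yk + \sum_(1 <= i < size bK) bK`_i * sig_back ys k i
            - \sum_(1 <= i < size aK) aK`_i * sig_back us k i in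
  let udk := alpha 0 * (del k == 0)%:R * uk
            + \sum_(1 <= i < tau.+1) alpha i * (del (k - i) == i)%:R * sig_back us k i in
  (yk, uk, v k - udk).

Fixpoint loop_hist (n : nat) : seq (R * R * R) :=
  if n is n'.+1 then rcons (loop_hist n') (loop_step n' (loop_hist n')) else [::].

Definition cl_u (k : nat) : R := (nth (0, 0, 0) (loop_hist k.+1) k).1.2.

Definition cl_d (p : nat -> R) (k : nat) : R :=
  \sum_(0 <= i < tau.+1)
     alpha i * ((del (k - i) == i)%:R - p i) * (if (i <= k)%N then cl_u (k - i) else 0).

End ClosedLoop.

Section Prob.
Context {R : realType} {d : measure_display} {T : measurableType d}.
Variable P : probability T R.

Definition bigI {I : Type} (J : seq I) (A : I -> set T) : set T :=
  \big[setI/setT]_(i <- J) A i.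

Definition events_nat (X : T -> nat) : set (set T) :=
  [set A | exists B : set nat, A = X @^-1` B].
Definition events_real (X : T -> R) : set (set T) :=
  [set A | exists B : set R, measurable B /\ A = X @^-1` B].

Definition mutual_indep {I : eqType} (E : I -> set (set T)) : Prop :=
  forall J : seq I, uniq J -> forall A : I -> set T,
    (forall i, i \in J -> E i (A i)) ->
    P (bigI J A) = (\prod_(i <- J) P (A i))%E.

(* independence of two families (i.e. of the generated sigma-algebras) *)
Definition indep_families {I1 I2 : eqType}
    (E1 : I1 -> set (set T)) (E2 : I2 -> set (set T)) : Prop :=
  forall (J1 : seq I1) (J2 : seq I2) (A1 : I1 -> set T) (A2 : I2 -> set T),
    (forall i, i \in J1 -> E1 i (A1 i)) ->
    (forall j, j \in J2 -> E2 j (A2 j)) ->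
    P (bigI J1 A1 `&` bigI J2 A2) = (P (bigI J1 A1) * P (bigI J2 A2))%E.

Definition delay_process (tau : nat) (p : nat -> R) (del : nat -> T -> nat) : Prop :=
  (forall n w, (del n w <= tau)%N) /\
  (forall n (B : set nat), measurable (del n @^-1` B)) /\
  (forall n i, (i <= tau)%N -> P (del n @^-1` [set i]) = (p i)%:E) /\
  mutual_indep (fun n => events_nat (del n)).

Definition white_noise (v : nat -> T -> R) : Prop :=
  (forall k, measurable_fun setT (v k)) /\
  (forall k, P.-integrable setT (fun w => ((v k w) ^+ 2)%:E)) /\
  (forall k, (\int[P]_w (v k w)%:E = 0)%E) /\
  (forall j k, j != k -> (\int[P]_w (v j w * v k w)%:E = 0)%E) /\
  (exists M : R, forall k, (\int[P]_w ((v k w) ^+ 2)%:E <= M%:E)%E).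

End Prob.

Definition ms_stable (R : realType) (tau : nat) (alpha p : nat -> R)
    (bP aP bK aK : {poly R}) : Prop :=
  stable_tf (G_num bP bK) (G_den tau alpha p bP aP bK aK) /\
  forall (d' : measure_display) (T' : measurableType d') (P' : probability T' R)
         (del : nat -> T' -> nat) (v : nat -> T' -> R),
    delay_process P' tau p del ->
    white_noise P' v ->
    indep_families P' (fun k => events_real (v k)) (fun n => events_nat (del n)) ->
    exists M : R, forall k,
      (\int[P']_w ((cl_d bP aP bK aK tau alpha (fun j => v j w) (fun n => del n w) p k) ^+ 2)%:E
         <= M%:E)%E /\
      (\int[P']_w ((cl_u bP aP bK aK tau alpha (fun j => v j w) (fun n => del n w) k) ^+ 2)%:E
         <= M%:E)%E.

(* Main.v *)
(* Writing g for the impulse response of G and c_t for that of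
   G (alpha_t z^-t - H), the loop reads
     u(k) = (g * v)(k) - sum_(n < k) c_(tau_n)(k - n) u(n),
   and c_(tau_n) has mean zero and is independent of v and of u up to time n.
   All cross terms of E u(k)^2 therefore vanish, leaving the renewal equation
     x = g^2 * sv + s * x,   s = sum_t p_t c_t^2,
   for x(k) = E u(k)^2.  With r the renewal sequence of s, x = r * (g^2 * sv).

   A spectral factor exists only if some 0 < p_t < 1.  Then
   1(tau_(2k+1) = t) - p_t is a noise independent of the delays tau_(2n), with
   constant positive variance, and stability against it bounds the partial sums
   of g^2 and of r.  Hence (1 - sum s) (sum r) = 1, and the limit of x is
   (sum r) (sum g^2) times the limit of sv.

   Finally sum g^2 and sum s are squared H2 norms by Parseval, applied to the
   truncations of the series, which converge uniformly on the circle because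
   the coefficients tend to 0; and on the circle |Phi|^2 is the variance
   sum_t p_t |alpha_t z^-t - H|^2. *)
From HB Require Import structures.
Require Import Defs.
From mathcomp Require Import all_boot all_order all_algebra.
From mathcomp Require Import all_classical all_reals all_analysis.
From mathcomp Require Import measurable_realfun.
From mathcomp Require Import ring lra.
From mathcomp.real_closed Require Import complex.
Import Order.TTheory GRing.Theory Num.Theory numFieldNormedType.Exports.

Set Implicit Arguments.
Unset Strict Implicit.
Unset Printing Implicit Defensive.

Local Open Scope ring_scope.
Local Open Scope classical_set_scope.

(** * Expectations of products of independent variables *)

(** Conditioning on the past is replaced by finite algebra. The signal u(k) is a linear combination
    of v(0), ..., v(k) whose coefficients are functions of the delays before k, that is, of finitely
    many discrete variables. The mean of such a coefficient is an iterated finite sum, and the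
    probability space enters only through means of products of noise values with indicators of delay
    cylinders. The delay tau_k is absent from u(k) because P is strictly proper; this is what makes
    c_(tau_k) independent of u(k).

    Mean-square stability speaks of every admissible noise, so it is informative only once a noise
    with variance bounded away from zero is exhibited. A space carrying such a noise beside the
    delays would be an infinite product; splitting the delays by parity avoids building one.
    Stability of G provides a fraction whose denominator has no zero on the circle, whereas the
    decay of g is read off the boundedness of second moments. *)

Section Mean.
Context {R : realType} {d : measure_display} {T : measurableType d}.
Variable P : probability T R.

(** Integrability travels with the value, because linearity of the extended-real integral requires
    it. *)
Definition has_mean (f : T -> R) (m : R) : Prop :=
  P.-integrable setT (EFin \o f) /\ (\int[P]_w (f w)%:E = m%:E)%E.

Lemma has_mean_measurable f m : has_mean f m -> measurable_fun setT f.
Proof. by case=> /integrableP[/measurable_EFinP]. Qed.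

Lemma eq_has_mean f g m : f =1 g -> has_mean f m -> has_mean g m.
Proof. by move=> /funext ->. Qed.

Lemma has_mean_cst c : has_mean (fun=> c) c.
Proof.
split; first exact: finite_measure_integrable_cst.
rewrite -[LHS]/(\int[P]_w (cst c%:E) w)%E integral_cst// -[RHS]mule1; congr (_ * _)%E.
exact: probability_setT.
Qed.

Lemma has_meanD f g a b :
  has_mean f a -> has_mean g b -> has_mean (fun w => f w + g w) (a + b).
Proof.
move=> [fi fa] [gi gb]; split; first exact: integrableD fi gi.
by rewrite -[LHS]/(\int[P]_w ((EFin \o f) w + (EFin \o g) w))%E integralD// fa gb.
Qed.

Lemma has_meanZ c f a : has_mean f a -> has_mean (fun w => c * f w) (c * a).
Proof.
move=> [fi fa]; split; first exact: (integrableZl _ c fi).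
by rewrite -[LHS]/(\int[P]_w (c%:E * (EFin \o f) w))%E integralZl// fa.
Qed.

Lemma has_mean_sum (I : Type) (s : seq I) (f : I -> T -> R) (a : I -> R) :
  (forall i, has_mean (f i) (a i)) ->
  has_mean (fun w => \sum_(i <- s) f i w) (\sum_(i <- s) a i).
Proof.
move=> fa; elim: s => [|i s ih].
  by rewrite big_nil; under eq_fun do rewrite big_nil; exact: has_mean_cst.
by rewrite big_cons; under eq_fun do rewrite big_cons; exact: has_meanD.
Qed.

(** The law of (X, Y) agrees with the product of the two laws on rectangles, hence everywhere.
    Tonelli then gives integrability of the product from that of each factor, and Fubini gives its
    value. *)
Lemma has_meanM_indep (X Y : T -> R) a b :
  (forall B C, measurable B -> measurable C ->
     P (X @^-1` B `&` Y @^-1` C) = P (X @^-1` B) * P (Y @^-1` C))%E ->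
  has_mean X a -> has_mean Y b -> has_mean (fun w => X w * Y w) (a * b).
Proof.
move=> ind hX hY.
have mX := has_mean_measurable hX; have mY := has_mean_measurable hY.
have mXY : measurable_fun setT (fun w => (X w, Y w)) by exact: measurable_fun_pair.
pose X' : {RV P >-> R} := HB.pack X (isMeasurableFun.Build _ _ _ _ _ mX).
pose Y' : {RV P >-> R} := HB.pack Y (isMeasurableFun.Build _ _ _ _ _ mY).
pose Z : {RV P >-> (R * R)%type} :=
  HB.pack (fun w => (X w, Y w)) (isMeasurableFun.Build _ _ _ _ _ mXY).
pose LX := distribution P X'; pose LY := distribution P Y'; pose LZ := distribution P Z.
have lawE A : measurable A -> (LX \x LY)%E A = LZ A.
  by apply: product_measure_unique => B C mB mC; rewrite /LX/LY/LZ /distribution/pushforward/= -ind.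
pose f (z : R * R) : \bar R := (z.1 * z.2)%:E.
have mf : measurable_fun setT f.
  by apply/measurable_EFinP; apply: measurable_funM; [exact: measurable_fst|exact: measurable_snd].
have iX : LX.-integrable setT EFin.
  apply: integrable_pushforward => //.
  by case: hX.
have iY : LY.-integrable setT EFin.
  apply: integrable_pushforward => //.
  by case: hY.
have EX : (\int[LX]_x x%:E = a%:E)%E.
  rewrite integral_pushforward//; by case: hX.
have EY : (\int[LY]_x x%:E = b%:E)%E.
  rewrite integral_pushforward//; by case: hY.
have ip : (LX \x LY)%E.-integrable setT f.
  apply/integrable12ltyP => //.
  pose c := (\int[LY]_y `|y%:E|)%E.
  have c0 : (0 <= c)%E by exact: integral_ge0.
  have coo : (c < +oo)%E by case/integrableP: iY.
  rewrite (eq_integral (fun x : R => `|x%:E| * c)%E); last first.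
    move=> x _; rewrite /f -ge0_integralZl//.
    - by apply: eq_integral => y _; rewrite /= normrM EFinM.
    - exact: measurableT_comp.
  rewrite ge0_integralZr//; last exact: measurableT_comp.
  rewrite lte_mul_pinfty//; first exact: integral_ge0.
    rewrite ge0_fin_numE; first by case/integrableP: iX.
    exact: integral_ge0.
have E1 : (\int[LX \x LY]_z f z = (a * b)%:E)%E.
  rewrite -integral12_prod_meas1//.
  rewrite (eq_integral (fun x : R => x%:E * b%:E)%E); last first.
    move=> x _; rewrite /fubini_F /f -EY -integralZl//.
  by rewrite integralZr// EX.
have iZ : P.-integrable setT (f \o Z).
  apply/integrableP; split.
    exact: measurableT_comp.
  have /integrableP[_] := ip.
  rewrite (eq_measure_integral LZ); last first. by move=> A mA _; exact: lawE.
  rewrite ge0_integral_pushforward//; last first. exact: measurableT_comp.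
split => //.
rewrite -E1 (eq_measure_integral LZ); last first.  by move=> A mA _; exact: lawE.
by rewrite integral_pushforward.
Qed.

End Mean.

Section MeanIndicator.
Context {R : realType} {d : measure_display} {T : measurableType d}.
Variable P : probability T R.

Let prE (A : set T) : measurable A -> P A = (fine (P A))%:E.
Proof. by move=> mA; rewrite fineK// fin_num_measure. Qed.

Let measurable_preim (X : T -> R) (B : set R) :
  measurable_fun setT X -> measurable B -> measurable (X @^-1` B).
Proof. by move=> mX mB; rewrite -[X in measurable X]setTI; exact: mX. Qed.

Lemma indep_setC (A C : set T) : measurable A -> measurable C ->
  (P (A `&` C) = P A * P C -> P (~` A `&` C) = P (~` A) * P C)%E.
Proof.
move=> mA mC AC.
have mCA := measurableC mA.
have sC : (P C = P (A `&` C) + P (~` A `&` C))%E.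
  rewrite -measureU.
  - by rewrite -setIUl setUv setTI.
  - exact: measurableI.
  - exact: measurableI.
  - by rewrite setIACA setICr set0I.
have s1 : (1 = P A + P (~` A))%E.
  rewrite -measureU.
  - by rewrite setUv; exact/esym/probability_setT.
  - by [].
  - by [].
  - by rewrite setICr.
move: sC s1; rewrite AC (prE mA) (prE mC) (prE mCA) (prE (measurableI _ _ mCA mC)).
rewrite -!EFinM -!EFinD => -[sC] [s1]; congr EFin.
move: s1 sC; set x := fine (P (_ `&` _)); set y := fine (P (~` A)).
set u := fine (P A); set c := fine (P C) => s1 sC.
have -> : y = 1 - u by move: s1; rewrite -[1%R in LHS]/(1 : R) => ->; ring.
by apply: (addrI (u * c)); rewrite -sC; ring.
Qed.

(** A preimage under an indicator is the whole space, A, its complement or empty, so independence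
    from the single event A is enough. *)
Lemma has_mean_indicM (A : set T) (X : T -> R) a m : measurable A ->
  P A = a%:E ->
  (forall B, measurable B -> P (A `&` X @^-1` B) = P A * P (X @^-1` B))%E ->
  has_mean P X m -> has_mean P (fun w => \1_A w * X w) (a * m).
Proof.
move=> mA Aa ind hX; have mX := has_mean_measurable hX.
apply: has_meanM_indep hX.
  move=> B C mB mC; rewrite preimage_indic; case: ifP => _; case: ifP => _.
  - rewrite setTI -[LHS]mul1e; congr (_ * _)%E; exact/esym/probability_setT.
  - exact: ind.
  - by apply: indep_setC; rewrite ?ind//; exact: measurable_preim.
  - by rewrite set0I measure0 mul0e.
split; first exact: integrable_indic.
by rewrite integral_indic// setIT.
Qed.

Lemma has_mean_indicMM0 (A : set T) (X Y : T -> R) : measurable A ->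
  (forall B C, measurable B -> measurable C ->
     P (A `&` (X @^-1` B `&` Y @^-1` C)) =
     P A * (P (X @^-1` B) * P (Y @^-1` C)))%E ->
  has_mean P X 0 -> has_mean P Y 0 ->
  has_mean P (fun w => \1_A w * (X w * Y w)) 0.
Proof.
move=> mA ind hX hY.
have mX := has_mean_measurable hX; have mY := has_mean_measurable hY.
have PT : P setT = 1%E by exact: probability_setT.
have indX B : measurable B -> (P (A `&` X @^-1` B) = P A * P (X @^-1` B))%E.
  move=> mB; have := ind B setT mB measurableT.
  by rewrite preimage_setT setIT PT mule1.
have indY B : measurable B -> (P (A `&` Y @^-1` B) = P A * P (Y @^-1` B))%E.
  move=> mB; have := ind setT B measurableT mB.
  by rewrite preimage_setT setTI PT mul1e.
have hAX : has_mean P (fun w => \1_A w * X w) 0.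
  rewrite -(mulr0 (fine (P A))); apply: has_mean_indicM => //.
  exact: prE.
rewrite -(mulr0 0); apply: (@eq_has_mean _ _ _ _ (fun w => (\1_A w * X w) * Y w)).
  by move=> w; rewrite mulrA.
apply: has_meanM_indep hAX hY => B C mB mC.
(* The product [\1_A * X] vanishes off A, so the complement of A belongs to the preimage of [B]
   exactly when [B] contains 0. *)
pose Z := if 0 \in B then ~` A else set0.
have mZ : measurable Z by rewrite /Z; case: ifP => _ //; exact: measurableC.
have -> : (fun w => \1_A w * X w) @^-1` B = (A `&` X @^-1` B) `|` Z.
  apply/seteqP; split => w /=; rewrite /Z indicE.
    have [wA|wA] := boolP (w \in A).
      by rewrite mul1r => ?; left; split => //; exact/set_mem.
    rewrite mul0r => /mem_set ->; right => /= /mem_set; exact/negP.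
  case=> [[/mem_set -> ?]|]; first by rewrite mul1r.
  case: ifP => // /set_mem B0 /= wA.
  by rewrite memNset// mul0r.
have dZ : (A `&` X @^-1` B) `&` Z = set0.
  by apply/seteqP; split => // w [[wA _]]; rewrite /Z; case: ifP.
have ZY : (P (Z `&` Y @^-1` C) = P Z * P (Y @^-1` C))%E.
  rewrite /Z; case: ifP => _; last by rewrite set0I measure0 mul0e.
  by apply: indep_setC; rewrite ?indY//; exact: measurable_preim.
have mXB : measurable (A `&` X @^-1` B) by apply: measurableI => //; exact: measurable_preim.
have mYC : measurable (Y @^-1` C) by exact: measurable_preim.
have PU : (P ((A `&` X @^-1` B) `|` Z) = P (A `&` X @^-1` B) + P Z)%E.
  exact: measureU.
have -> : (P (((A `&` X @^-1` B) `|` Z) `&` Y @^-1` C) =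
   P ((A `&` X @^-1` B) `&` Y @^-1` C) + P (Z `&` Y @^-1` C))%E.
  rewrite setIUl; apply: measureU; [exact: measurableI|exact: measurableI|].
  by rewrite setIACA dZ set0I.
rewrite PU ZY -setIA ind// indX//.
rewrite (prE mA) (prE mYC) (prE mZ) (prE (measurable_preim mX mB)).
by rewrite -!EFinM -EFinD; congr EFin; ring.
Qed.

End MeanIndicator.

(** * Functionals of the delays *)

Definition upd (D : nat -> nat) (n t : nat) : nat -> nat :=
  fun m => if m == n then t else D m.

Section DelayAverage.
Context {R : comNzRingType}.
Variables (tau : nat) (p : nat -> R).
Implicit Types (F G : (nat -> nat) -> R) (D : nat -> nat).

Definition depends_below (N : nat) F : Prop :=
  forall D D', (forall n, (n < N)%N -> D n = D' n) -> F D = F D'.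

(* Expectation of a functional of the delays over the first N of them, the
   later coordinates being frozen at 0. *)
Fixpoint delay_mean (N : nat) F : R :=
  if N is n.+1 then delay_mean n (fun D => \sum_(t < tau.+1) p t * F (upd D n t))
  else F (fun=> 0%N).

Lemma eq_delay_mean N F G : F =1 G -> delay_mean N F = delay_mean N G.
Proof. by move=> /funext ->. Qed.

Lemma delay_meanD N F G : delay_mean N (fun D => F D + G D) = delay_mean N F + delay_mean N G.
Proof.
elim: N F G => //= N ih F G; rewrite -ih; apply: eq_delay_mean => D.
by rewrite -big_split; apply: eq_bigr => t _; rewrite mulrDr.
Qed.

Lemma delay_meanZ N c F : delay_mean N (fun D => c * F D) = c * delay_mean N F.
Proof.
elim: N F => //= N ih F; rewrite -ih; apply: eq_delay_mean => D.
by rewrite mulr_sumr; apply: eq_bigr => t _; rewrite mulrCA.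
Qed.

Lemma delay_mean0 N : delay_mean N (fun=> 0) = 0.
Proof.
rewrite -[RHS](mul0r (delay_mean N (fun=> 1))) -delay_meanZ.
by apply: eq_delay_mean => D; rewrite mul0r.
Qed.

Lemma delay_mean_sum N (I : Type) (s : seq I) (F : I -> (nat -> nat) -> R) :
  delay_mean N (fun D => \sum_(i <- s) F i D) = \sum_(i <- s) delay_mean N (F i).
Proof.
elim: s => [|i s ih].
  by rewrite big_nil -[RHS](delay_mean0 N); apply: eq_delay_mean => D; rewrite big_nil.
by rewrite big_cons -ih -delay_meanD; apply: eq_delay_mean => D; rewrite big_cons.
Qed.

Lemma depends_belowW M N F : (M <= N)%N -> depends_below M F -> depends_below N F.
Proof. by move=> MN FM D D' DD; apply: FM => n nM; apply: DD; exact: leq_trans MN. Qed.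

Lemma depends_below_upd N F t : depends_below N.+1 F -> depends_below N (fun D => F (upd D N t)).
Proof.
move=> FN D D' DD; apply: FN => n; rewrite ltnS leq_eqVlt /upd.
by case: eqP => //= _ /DD.
Qed.

Lemma upd_depends_below N F D t : depends_below N F -> F (upd D N t) = F D.
Proof. by apply => n nN; rewrite /upd ltn_eqF. Qed.

(** Algebraic form of the independence of delay [N] from the earlier ones. *)
Lemma delay_mean_last N F (c : nat -> R) : depends_below N F ->
  delay_mean N.+1 (fun D => c (D N) * F D) = (\sum_(t < tau.+1) p t * c t) * delay_mean N F.
Proof.
move=> FN /=; rewrite -delay_meanZ; apply: eq_delay_mean => D; rewrite mulr_suml.
by apply: eq_bigr => t _; rewrite upd_depends_below// {1}/upd eqxx mulrA.
Qed.

Hypothesis p1 : \sum_(t < tau.+1) p t = 1.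

(** Functionals with different horizons can thus be averaged over a common number of delays. *)
Lemma delay_mean_below M N F : depends_below M F -> (M <= N)%N -> delay_mean N F = delay_mean M F.
Proof.
move=> FM; elim: N => [|N ih]; first by rewrite leqn0 => /eqP ->.
rewrite leq_eqVlt => /predU1P[->//|]; rewrite ltnS => MN.
rewrite -ih//= ; apply: eq_delay_mean => D.
under eq_bigr do rewrite (upd_depends_below _ _ (depends_belowW MN FM)).
by rewrite -mulr_suml p1 mul1r.
Qed.

End DelayAverage.

Lemma sum_select (R : comNzRingType) (n t0 : nat) (f : nat -> R) : (t0 <= n)%N ->
  \sum_(t < n.+1) (t0 == t)%:R * f t = f t0.
Proof.
move=> t0n; have t0n1 : (t0 < n.+1)%N by [].
rewrite (bigD1 (Ordinal t0n1))//= eqxx mul1r big1 ?addr0// => t.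
by rewrite -val_eqE/= eq_sym => /negbTE ->; rewrite mul0r.
Qed.

Section Cylinder.
Context {R : realType} {d : measure_display} {T : measurableType d}.
Variables (P : probability T R) (tau : nat) (p : nat -> R) (del : nat -> T -> nat).
Hypothesis del_le : forall n w, (del n w <= tau)%N.

Variables (V : T -> R) (m : R).
Hypothesis cylV : forall k t, (forall n, (t n <= tau)%N) ->
  has_mean P (fun w => (\prod_(n <- iota 0 k) (del n w == t n)%:R) * V w)
           ((\prod_(n <- iota 0 k) p (t n)) * m).

(** The cylinder over the delays N, ..., N + k - 1 strengthens the induction on [N]: splitting on
    the value of delay [N] trades one argument of [F] for one more factor of the cylinder, until [F]
    is constant and the hypothesis on [V] applies. *)
Let has_mean_cylinder_functional N F : depends_below N F ->
  forall k t, (forall n, (t n <= tau)%N) ->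
  has_mean P
    (fun w => (\prod_(n <- iota N k) (del n w == t n)%:R) * (F (del ^~ w) * V w))
    ((\prod_(n <- iota N k) p (t n)) * (delay_mean tau p N F * m)).
Proof.
elim: N F => [|N ih] F FN k t tle.
  apply: (@eq_has_mean _ _ _ _ (fun w => F (fun=> 0%N) *
     ((\prod_(n <- iota 0 k) (del n w == t n)%:R) * V w))).
    by move=> w; rewrite (FN (del ^~ w) (fun=> 0%N))//; ring.
  by rewrite mulrCA; exact/has_meanZ/cylV.
pose G s w := (\prod_(n <- iota N k.+1) (del n w == upd t N s n)%:R) *
              (F (upd (del ^~ w) N s) * V w).
have prod_upd (f : nat -> nat -> R) s :
    \prod_(n <- iota N k.+1) f n (upd t N s n) =
    f N s * \prod_(n <- iota N.+1 k) f n (t n).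
  rewrite big_cons {1}/upd eqxx; congr (_ * _).
  rewrite big_seq [RHS]big_seq; apply: eq_bigr => n; rewrite mem_iota => /andP[Nn _].
  by rewrite /upd gtn_eqF.
have hG (s : 'I_tau.+1) : has_mean P (G s) ((\prod_(n <- iota N.+1 k) p (t n)) *
     (p s * delay_mean tau p N (fun D => F (upd D N s)) * m)).
  rewrite (_ : _ * _ = (p s * \prod_(n <- iota N.+1 k) p (t n)) *
    (delay_mean tau p N (fun D => F (upd D N s)) * m)); last by ring.
  rewrite -(prod_upd (fun=> p) s); apply: ih; first exact: depends_below_upd.
  by move=> n; rewrite /upd; case: eqP => // _; rewrite -ltnS.
rewrite [delay_mean tau p N.+1 F]/= delay_mean_sum mulr_suml mulr_sumr.
rewrite (eq_bigr (fun s : 'I_tau.+1 => (\prod_(n <- iota N.+1 k) p (t n)) *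
    (p s * delay_mean tau p N (fun D => F (upd D N s)) * m))); last first.
  by move=> s _; rewrite (delay_meanZ tau p N (p s) (fun D => F (upd D N s))).
apply: eq_has_mean (has_mean_sum (index_enum 'I_tau.+1) hG) => w.
rewrite (eq_bigr (fun s : 'I_tau.+1 => (del N w == s)%:R *
    (\prod_(n <- iota N.+1 k) (del n w == t n)%:R * (F (upd (del ^~ w) N s) * V w)))); last first.
  by move=> s _; rewrite mulrA -(prod_upd (fun n x => (del n w == x)%:R)).
rewrite (sum_select (fun s => \prod_(n <- iota N.+1 k) (del n w == t n)%:R *
  (F (upd (del ^~ w) N s) * V w)))//.
have -> // : upd (del ^~ w) N (del N w) = del ^~ w.
by apply/funext => n; rewrite /upd; case: eqP => // ->.
Qed.

Lemma has_mean_delay_functional N F : depends_below N F ->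
  has_mean P (fun w => F (del ^~ w) * V w) (delay_mean tau p N F * m).
Proof.
move=> FN; have := has_mean_cylinder_functional FN 0%N (fun=> leq0n _).
by rewrite big_nil mul1r; apply: eq_has_mean => w; rewrite big_nil mul1r.
Qed.

End Cylinder.

(** * Independence of the noise and the delays *)

Section Independence.
Context {R : realType} {d : measure_display} {T : measurableType d}.
Variable P : probability T R.

Lemma bigI_undup (I : eqType) (J : seq I) (A : I -> set T) :
  bigI (undup J) A = bigI J A.
Proof. by apply: big_undup; exact: setIid. Qed.

(** A left inverse is asked for rather than injectivity, because the events chosen over [I'] have to
    be re-indexed by [I], as [A \o psi]. *)
Lemma mutual_indep_reindex (I I' : eqType) (E : I -> set (set T))
    (E' : I' -> set (set T)) (phi : I' -> I) (psi : I -> I') :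
  cancel phi psi -> (forall i, E' i `<=` E (phi i)) ->
  mutual_indep P E -> mutual_indep P E'.
Proof.
move=> phiK sub ind J uJ A AE.
have := ind [seq phi i | i <- J] _ (A \o psi) _.
rewrite /bigI !big_map /=.
rewrite (eq_bigr A); last by move=> i _; rewrite phiK.
have -> : (\prod_(j <- J) P (A (psi (phi j))) = \prod_(j <- J) P (A j))%E.
  by apply: eq_bigr => i _; rewrite phiK.
apply; first by rewrite map_inj_uniq//; exact: can_inj phiK.
by move=> _ /mapP[i iJ ->] /=; rewrite phiK; apply: sub; exact: AE.
Qed.

Lemma indep_families_odd_even (E : nat -> set (set T)) : mutual_indep P E ->
  indep_families P (fun k => E k.*2.+1) (fun n => E n.*2).
Proof.
move=> ind J1 J2 A1 A2 AE1 AE2.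
have ind1 : mutual_indep P (fun k => E k.*2.+1).
  have phiK : cancel (fun k => k.*2.+1) half by move=> n; rewrite /= uphalf_double.
  exact: (mutual_indep_reindex phiK (fun n A EA => EA) ind).
have ind2 : mutual_indep P (fun k => E k.*2).
  exact: (mutual_indep_reindex doubleK (fun n A EA => EA) ind).
rewrite -(bigI_undup J1) -(bigI_undup J2) ind1 ?undup_uniq//; last first.
  by move=> i; rewrite mem_undup; exact: AE1.
rewrite ind2 ?undup_uniq//; last by move=> i; rewrite mem_undup; exact: AE2.
(* Interleaving by parity turns the two choices of events into a single one, to which mutual
   independence applies. *)
pose A m := if odd m then A1 m./2 else A2 m./2.
have := ind ([seq k.*2.+1 | k <- undup J1] ++ [seq k.*2 | k <- undup J2]) _ A _.
rewrite /bigI !big_cat !big_map /A /=.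
rewrite (eq_bigr A1); last by move=> i _; rewrite odd_double/= uphalf_double.
rewrite [X in _ `&` X](eq_bigr A2); last by move=> i _; rewrite odd_double/= doubleK.
set Q1 := (\prod_(i <- undup J1) _)%E; set Q2 := (\prod_(i <- undup J2) _)%E.
have -> : Q1 = (\prod_(j <- undup J1) P (A1 j))%E.
  by apply: eq_bigr => i _; rewrite odd_double/= uphalf_double.
have -> : Q2 = (\prod_(j <- undup J2) P (A2 j))%E.
  by apply: eq_bigr => i _; rewrite odd_double/= doubleK.
apply.
  rewrite cat_uniq !map_inj_uniq ?undup_uniq//=; last 2 first.
  - exact: double_inj.
  - by move=> x y [] /double_inj.
  rewrite andbT; apply/hasPn => _ /mapP[n _ ->]; apply/mapP => -[k _ /(congr1 odd)].
  by rewrite /= !odd_double.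
move=> i; rewrite mem_cat => /orP[] /mapP[n]; rewrite mem_undup => nJ ->.
  by rewrite /= odd_double/= uphalf_double; exact: AE1.
by rewrite odd_double/= doubleK; exact: AE2.
Qed.

End Independence.

Section NoiseFunctional.
Context {R : realType} {d : measure_display} {T : measurableType d}.
Variables (P : probability T R) (tau : nat) (p : nat -> R).
Variables (del : nat -> T -> nat) (v : nat -> T -> R) (sv : nat -> R).
Hypothesis delP : delay_process P tau p del.
Hypothesis v_indep : mutual_indep P (fun k => events_real (v k)).
Hypothesis v_del : indep_families P (fun k => events_real (v k)) (fun n => events_nat (del n)).
Hypothesis v_mean : forall k, has_mean P (v k) 0.
Hypothesis v_var : forall k, has_mean P (fun w => v k w ^+ 2) (sv k).

Let cyl k (t : nat -> nat) := bigI (iota 0 k) (fun n => del n @^-1` [set t n]).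

Let cylE k t w : \1_(cyl k t) w = \prod_(n <- iota 0 k) (del n w == t n)%:R :> R.
Proof.
rewrite /cyl /bigI; elim: (iota 0 k) => [|n s ih].
  by rewrite !big_nil indicT.
rewrite !big_cons indicI /= ih; congr (_ * _).
rewrite indicE; congr (nat_of_bool _)%:R.
by apply/idP/eqP => [/set_mem//|?]; exact/mem_set.
Qed.

Let cyl_measurable k t : measurable (cyl k t).
Proof.
rewrite /cyl /bigI; elim: (iota 0 k) => [|n s ih]; first by rewrite big_nil.
by rewrite big_cons; apply: measurableI => //; case: delP => _ [].
Qed.

Let cyl_prob k t : (forall n, (t n <= tau)%N) ->
  P (cyl k t) = (\prod_(n <- iota 0 k) p (t n))%:E.
Proof.
case: delP => _ [_] [pt ind] tle.
rewrite /cyl ind ?iota_uniq//; last by move=> i _; eexists.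
elim: (iota 0 k) => [|n s ih]; first by rewrite !big_nil.
by rewrite !big_cons ih pt// EFinM.
Qed.

Let cyl_event k t (J : seq nat) A : (forall i, i \in J -> events_real (v i) (A i)) ->
  P (cyl k t `&` bigI J A) = (P (cyl k t) * P (bigI J A))%E.
Proof.
move=> JA; rewrite setIC muleC; apply: v_del => // n _; by eexists.
Qed.

(** It suffices to test against delay cylinders. For equal indices a cylinder is independent of the
    square of [v i]; for distinct ones the cylinder, [v i] and [v j] are independent together and
    the means vanish. *)
Lemma has_mean_noise_functional N F i j : depends_below N F ->
  has_mean P (fun w => F (del ^~ w) * (v i w * v j w))
             (delay_mean tau p N F * ((i == j)%:R * sv i)).
Proof.
apply: has_mean_delay_functional; first by case: delP.
move=> k t tle.
apply: (@eq_has_mean _ _ _ _ (fun w => \1_(cyl k t) w * (v i w * v j w))).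
  by move=> w; rewrite cylE.
have [<-|ij] := eqVneq i j.
  rewrite mul1r; apply: has_mean_indicM => //; last 1 first.
  - by apply: eq_has_mean (v_var i) => w; rewrite expr2.
  - exact: cyl_prob.
  move=> B mB; have := @cyl_event k t [:: i] (fun=> v i @^-1` ((fun x => x * x) @^-1` B)).
  rewrite /bigI big_seq1; apply => n /[!inE] /eqP ->; eexists; split; last by [].
  rewrite -[X in measurable X]setTI.
  exact: (measurable_funM (@measurable_id _ _ setT) (@measurable_id _ _ setT)).
rewrite mul0r mulr0; apply: has_mean_indicMM0 => // B C mB mC.
pose A n := if n == i then v i @^-1` B else v j @^-1` C.
have ji : (j == i) = false by rewrite eq_sym (negbTE ij).
have AE n : n \in [:: i; j] -> events_real (v n) (A n).
  by rewrite !inE /A => /orP[] /eqP ->; rewrite ?eqxx ?ji; [exists B|exists C].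
have uij : uniq [:: i; j] by rewrite /= inE ij.
have := cyl_event k t AE; rewrite (v_indep uij AE).
by rewrite /bigI 2!big_cons big_nil setIT 2!big_cons big_nil mule1 /A eqxx ji.
Qed.

End NoiseFunctional.

Section DelayNoise.
Context {R : realType} {d : measure_display} {T : measurableType d}.
Variables (P : probability T R) (tau : nat) (p : nat -> R) (del : nat -> T -> nat).
Hypothesis delP : delay_process P tau p del.

(* The odd delays supply a noise independent of the even ones, so that the
   stability hypothesis can be tested on the given probability space. *)
Definition delay_noise (t k : nat) (w : T) : R := (del k.*2.+1 w == t)%:R - p t.

Lemma delay_process_even : delay_process P tau p (fun n => del n.*2).
Proof.
case: delP => del_le [del_meas [del_p ind]].
split; first by move=> n w; exact: del_le.
split; first by move=> n B; exact: del_meas.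
split; first by move=> n i; exact: del_p.
exact: (mutual_indep_reindex doubleK (fun n A EA => EA) ind).
Qed.

Let delay_noise_event t k A : events_real (delay_noise t k) A ->
  events_nat (del k.*2.+1) A.
Proof.
by case=> B [mB ->]; exists [set s | ((s == t)%:R - p t : R) \in B]; apply/seteqP;
  split => w /=; [move/mem_set|move/set_mem].
Qed.

Lemma delay_noise_indep t : mutual_indep P (fun k => events_real (delay_noise t k)).
Proof.
case: delP => _ [_] [_ ind].
have phiK : cancel (fun k => k.*2.+1) half by move=> n; rewrite /= uphalf_double.
exact: (mutual_indep_reindex phiK (@delay_noise_event t) ind).
Qed.

Lemma delay_noise_even t : indep_families P
  (fun k => events_real (delay_noise t k)) (fun n => events_nat (del n.*2)).
Proof.
case: delP => _ [_] [_ /indep_families_odd_even ind] J1 J2 A1 A2 AE1 AE2.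
by apply: ind => // i iJ; apply: delay_noise_event (AE1 i iJ).
Qed.

Lemma has_mean_delay_eq t n : (t <= tau)%N ->
  has_mean P (fun w => (del n w == t)%:R) (p t).
Proof.
case: delP => _ [del_meas [del_p _]] tle.
apply: (@eq_has_mean _ _ _ _ (\1_(del n @^-1` [set t]))).
  move=> w; rewrite indicE; congr (nat_of_bool _)%:R.
  by apply/idP/eqP => [/set_mem//|?]; exact/mem_set.
split; first exact: integrable_indic.
by rewrite integral_indic// setIT; exact: del_p.
Qed.

Lemma has_mean_delay_noise t k : (t <= tau)%N -> has_mean P (delay_noise t k) 0.
Proof.
move=> tle; rewrite -(subrr (p t)).
exact: has_meanD (has_mean_delay_eq _ tle) (has_mean_cst P (- p t)).
Qed.

Lemma has_mean_delay_noise_sq t k : (t <= tau)%N ->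
  has_mean P (fun w => delay_noise t k w ^+ 2) (p t * (1 - p t)).
Proof.
(* An indicator X is idempotent, so (X - p)^2 = (1 - 2p) X + p^2 is affine in X. *)
move=> tle; rewrite (_ : p t * _ = (1 - 2 * p t) * p t + p t ^+ 2); last by ring.
apply: eq_has_mean (has_meanD (has_meanZ (1 - 2 * p t) (has_mean_delay_eq k.*2.+1 tle))
  (has_mean_cst P (p t ^+ 2))) => w.
by rewrite /delay_noise; case: (_ == t) => /=; ring.
Qed.

Lemma white_delay_noise t : (t <= tau)%N -> white_noise P (delay_noise t).
Proof.
move=> tle; split; first by move=> k; exact: has_mean_measurable (has_mean_delay_noise k tle).
split; first by move=> k; case: (has_mean_delay_noise_sq k tle).
split; first by move=> k; case: (has_mean_delay_noise k tle).
split.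
  move=> j k jk.
  (* With the constant functional 1 of no delay at all, this is plain decorrelation of the noise. *)
  have [|_] := @has_mean_noise_functional _ _ _ P tau p _ _ _ delay_process_even
    (@delay_noise_indep t) (@delay_noise_even t)
    (fun k => has_mean_delay_noise k tle) (fun k => has_mean_delay_noise_sq k tle) 0%N (fun=> 1) j k.
    by [].
  rewrite (negbTE jk) mul0r mulr0 => E0.
  rewrite -[RHS]/(0%:E)%E -E0.
  by apply: eq_integral => w _; rewrite mul1r.
by exists (p t * (1 - p t)) => k; case: (has_mean_delay_noise_sq k tle) => _ ->.
Qed.

End DelayNoise.

(** * Convolution of causal sequences *)

Section Convolution.
Context {R : comNzRingType}.
Implicit Types (a b c : nat -> R) (q : {poly R}).

Definition conv a b (k : nat) : R := \sum_(i < k.+1) a i * b (k - i)%N.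

Definition coefs q (i : nat) : R := q`_i.

Let trunc N a : {poly R} := \poly_(i < N) a i.

(** Below order [N] a convolution is a product of polynomials, so commutativity and associativity
    are inherited from the polynomial ring. *)
Let conv_trunc N a b k : (k < N)%N -> conv a b k = (trunc N a * trunc N b)`_k.
Proof.
move=> kN; rewrite coefM; apply: eq_bigr => i _; rewrite !coef_poly.
by rewrite (leq_ltn_trans _ kN) ?(leq_ltn_trans _ kN) ?leq_subr// -ltnS.
Qed.

Lemma eq_conv a a' b b' k : (forall i, (i <= k)%N -> a i = a' i) ->
  (forall i, (i <= k)%N -> b i = b' i) -> conv a b k = conv a' b' k.
Proof.
move=> aa bb; apply: eq_bigr => i _.
by rewrite aa ?bb ?leq_subr// -ltnS.
Qed.

Lemma convC a b : conv a b = conv b a.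
Proof. by apply/funext => k; rewrite !(@conv_trunc k.+1)// mulrC. Qed.

Let coef_trunc_conv N a b i : (i < N)%N ->
  (trunc N (conv a b))`_i = (trunc N a * trunc N b)`_i.
Proof. by move=> iN; rewrite coef_poly iN (@conv_trunc N). Qed.

Lemma convA a b c : conv a (conv b c) = conv (conv a b) c.
Proof.
apply/funext => k; pose N := k.+1.
have E x y z : conv x (conv y z) k = (trunc N x * (trunc N y * trunc N z))`_k.
  rewrite (@conv_trunc N)// !coefM; apply: eq_bigr => i _; congr (_ * _).
  by apply: coef_trunc_conv; rewrite ltnS leq_subr.
by rewrite (convC (conv a b)) !E mulrA mulrC.
Qed.

Lemma convDr a b c : conv a (fun i => b i + c i) = fun k => conv a b k + conv a c k.
Proof.
by apply/funext => k; rewrite -big_split; apply: eq_bigr => i _; rewrite mulrDr.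
Qed.

Lemma convBr a b c : conv a (fun i => b i - c i) = fun k => conv a b k - conv a c k.
Proof.
by apply/funext => k; rewrite -sumrB; apply: eq_bigr => i _; rewrite mulrBr.
Qed.

Lemma convZr x a b : conv a (fun i => x * b i) = fun k => x * conv a b k.
Proof.
by apply/funext => k; rewrite mulr_sumr; apply: eq_bigr => i _; rewrite mulrCA.
Qed.

Lemma conv_sumr (I : Type) (s : seq I) a (f : I -> nat -> R) :
  conv a (fun k => \sum_(i <- s) f i k) = fun k => \sum_(i <- s) conv a (f i) k.
Proof.
apply/funext => k; rewrite exchange_big /=; apply: eq_bigr => i _.
by rewrite mulr_sumr.
Qed.

Lemma conv_coefs q q' : conv (coefs q) (coefs q') = coefs (q * q').
Proof. by apply/funext => k; rewrite /coefs coefM. Qed.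

Lemma convDl a b c : conv (fun i => a i + b i) c = fun k => conv a c k + conv b c k.
Proof. by rewrite convC convDr !(convC c). Qed.

Lemma conv_rev a b k : conv a b k = \sum_(n < k.+1) a (k - n)%N * b n.
Proof. by rewrite convC; apply: eq_bigr => n _; rewrite mulrC. Qed.

Definition unit_pulse (j k : nat) : R := (k == j)%:R.

Lemma conv_pulse a j k : conv a (unit_pulse j) k = if (j <= k)%N then a (k - j)%N else 0.
Proof.
rewrite conv_rev /unit_pulse; case: ifPn => jk.
  have jk1 : (j < k.+1)%N by [].
  rewrite (bigD1 (Ordinal jk1))//= eqxx mulr1 big1 ?addr0// => i.
  by rewrite -val_eqE /= => /negbTE ->; rewrite mulr0.
rewrite big1// => i _; case: eqP => [ij|_]; last by rewrite mulr0.
by move: jk; rewrite -ij -ltnNge ltnNge -ltnS ltn_ord.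
Qed.

Lemma conv_cancel a b c : a 0%N = 1 -> conv a b = conv a c -> b = c.
Proof.
move=> a0 abc; apply/funext => k; elim/ltn_ind: k => k ih.
have := congr1 (fun f => f k) abc; rewrite /conv !big_ord_recl /= !subn0 a0 !mul1r.
rewrite (eq_bigr (fun i : 'I_k => a (bump 0 i) * c (k - bump 0 i)%N)); first exact: addIr.
by move=> i _; rewrite ih// ltn_subrL /bump (leq_ltn_trans _ (ltn_ord i)).
Qed.

(** Course-of-values recursion over the list of past values. The zeros from index [k] on are the
    default of [nth]; they spare a hypothesis that [F k] looks only at the past. *)
Lemma exists_recursive (F : nat -> (nat -> R) -> R) :
  exists g : nat -> R, forall k, g k = F k (fun i => if (i < k)%N then g i else 0).
Proof.
pose fix hist n : seq R :=
  if n is n'.+1 then rcons (hist n') (F n' (nth 0 (hist n'))) else [::].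
have size_hist n : size (hist n) = n by elim: n => //= n ih; rewrite size_rcons ih.
have nth_hist n k : (k < n)%N -> nth 0 (hist n) k = F k (nth 0 (hist k)).
  elim: n => // n ih; rewrite ltnS leq_eqVlt => /predU1P[->|kn] /=.
    by rewrite nth_rcons size_hist ltnn eqxx.
  by rewrite nth_rcons size_hist kn ih.
exists (fun k => nth 0 (hist k.+1) k) => k; rewrite nth_hist//; congr (F k _).
apply/funext => i; case: ltnP => ik; last by rewrite nth_default// size_hist.
by rewrite !nth_hist.
Qed.

(** Division of formal power series: impulse responses exist before any question of convergence. *)
Lemma conv_solve a b : a 0%N = 1 -> exists g, conv a g = b.
Proof.
move=> a0.
have [g gE] := exists_recursive (fun k h => b k - \sum_(i < k) a i.+1 * h (k - i.+1)%N).
exists g; apply/funext => k; rewrite /conv big_ord_recl subn0 a0 mul1r gE.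
rewrite -[RHS](subrK (\sum_(i < k) a i.+1 * g (k - i.+1)%N)); congr (_ - _ + _).
by apply: eq_bigr => i _; rewrite ltn_subrL /= (leq_ltn_trans _ (ltn_ord i)).
Qed.

End Convolution.

(** * The closed loop as a convolution equation *)

Section Loop.
Variable R : realType.
Variables (bP aP bK aK : {poly R}) (tau : nat) (alpha p : nat -> R).

(** The summand vanishes from [N] on because of [a], and beyond [k] because the signal is at rest,
    so both sums extend to [maxn N k.+1]. *)
Lemma sum_delayed_conv (N k : nat) (a x : nat -> R) :
  (forall i, (N <= i)%N -> a i = 0) ->
  \sum_(0 <= i < N) a i * (if (i <= k)%N then x (k - i)%N else 0) = conv a x k.
Proof.
move=> a0; pose f i := a i * (if (i <= k)%N then x (k - i)%N else 0).
have extend M M' : (forall i, (M <= i)%N -> f i = 0) ->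
    \sum_(0 <= i < M) f i = \sum_(0 <= i < maxn M M') f i.
  move=> f0; rewrite (@big_cat_nat _ _ _ M _ (maxn M M'))//= ?leq_maxl//.
  rewrite [X in _ + X]big_nat_cond [X in _ + X]big1 ?addr0// => i.
  by rewrite andbT => /andP[Mi _]; exact: f0.
rewrite -[LHS]/(\sum_(0 <= i < N) f i) (extend _ k.+1); last first.
  by move=> i Ni; rewrite /f a0// mul0r.
rewrite maxnC -extend; last by move=> i ki; rewrite /f leqNgt ki mulr0.
by rewrite big_mkord; apply: eq_bigr => i _; rewrite /f -ltnS ltn_ord.
Qed.

Section Signals.
Variables (v : nat -> R) (del : nat -> nat).

Let hist := loop_hist bP aP bK aK tau alpha v del.
Let st k := nth (0, 0, 0) (hist k.+1) k.
Let y k := (st k).1.1.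
Let u := cl_u bP aP bK aK tau alpha v del.
Let e k := (st k).2.
Let dd := cl_d bP aP bK aK tau alpha v del p.

Let size_hist n : size (hist n) = n.
Proof. by elim: n => // n ih; rewrite /hist/= size_rcons ih. Qed.

Let nth_hist n k : (k < n)%N -> nth (0, 0, 0) (hist n) k = st k.
Proof.
have E m i : (i < m)%N -> nth (0, 0, 0) (hist m) i =
    loop_step bP aP bK aK tau alpha v del i (hist i).
  elim: m => // m ih; rewrite ltnS leq_eqVlt => /predU1P[->|im] /=.
    by rewrite /hist/= nth_rcons size_hist ltnn eqxx.
  by rewrite /hist/= nth_rcons size_hist im ih.
by move=> kn; rewrite /st !E.
Qed.

Let st_step k : st k = loop_step bP aP bK aK tau alpha v del k (hist k).
Proof. by rewrite /st /hist /= nth_rcons size_hist ltnn eqxx. Qed.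

(** The sums in [loop_step] start at lag 1, so the term of lag 0 is taken off the convolution; when
    [N] is 0 that term is zero. *)
Let sum_back (pr : R * R * R -> R) N k (a : nat -> R) : pr (0, 0, 0) = 0 ->
  (forall i, (N <= i)%N -> a i = 0) ->
  \sum_(1 <= i < N) a i * sig_back (map pr (hist k)) k i =
  conv a (fun k => pr (st k)) k - a 0%N * pr (st k).
Proof.
move=> pr0 a0.
rewrite -(sum_delayed_conv _ _ a0) (eq_big_nat _ _ (F2 := fun i => a i *
    (if (i <= k)%N then pr (st (k - i)%N) else 0))).
  have [N0|N0] := posnP N; last by rewrite [in RHS]big_ltn//= subn0 addrAC subrr add0r.
  by rewrite N0 !big_geq// a0 ?N0// mul0r subr0.
move=> i /andP[i0 _]; rewrite /sig_back; case: ifPn => // ik.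
have kik : (k - i < k)%N by rewrite ltn_subrL i0 (leq_trans i0 ik).
by rewrite (nth_map (0, 0, 0)) ?size_hist// nth_hist.
Qed.

Let coefs_default (q : {poly R}) i : (size q <= i)%N -> coefs q i = 0 :> R.
Proof. exact: nth_default. Qed.

Hypotheses (bP0 : bP`_0 = 0) (aP0 : aP`_0 = 1) (aK0 : aK`_0 = 1).

Let sum_poly (q : {poly R}) (pr : R * R * R -> R) k : pr (0, 0, 0) = 0 ->
  \sum_(1 <= i < size q) q`_i * sig_back (map pr (hist k)) k i =
  conv (coefs q) (fun k => pr (st k)) k - q`_0 * pr (st k).
Proof. by move=> pr0; exact: (@sum_back pr _ k (coefs q) pr0 (@coefs_default q)). Qed.

Let plant : conv (coefs aP) y = conv (coefs bP) e.
Proof.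
apply/funext => k.
have : y k = _ := congr1 (fun t => t.1.1) (st_step k).
rewrite /= (@sum_poly bP (fun t => t.2))// (@sum_poly aP (fun t => t.1.1))//.
rewrite aP0 bP0 mul0r subr0 mul1r -/(y k) -/y -/e => yE.
by move: yE; lra.
Qed.

Let controller : conv (coefs aK) u = conv (coefs bK) y.
Proof.
apply/funext => k.
have := congr1 (fun t => t.1.2) (st_step k).
have yE : y k = _ := congr1 (fun t => t.1.1) (st_step k).
rewrite /= -[X in _ * X]yE (@sum_poly bK (fun t => t.1.1))// (@sum_poly aK (fun t => t.1.2))//.
rewrite aK0 mul1r -/(y k) -/y -/(u k) -/u => uE.
by move: uE; lra.
Qed.

(** Writing each indicator as p_i plus its deviation splits u_d into the mean channel and [d]. *)
Let channel k : e k = v k - (conv (coefs (Hpoly tau alpha p)) u k + dd k).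
Proof.
have uE : u k = _ := congr1 (fun t => t.1.2) (st_step k).
have -> : e k = _ := congr1 snd (st_step k).
rewrite /= -[X in _ * _ * X]uE.
congr (_ - _).
rewrite -(@sum_delayed_conv tau.+1); last first.
  by move=> i ti; rewrite /coefs coef_poly ltnNge ti.
rewrite /dd /cl_d -big_split /= [RHS]big_ltn//= subn0; congr (_ + _).
  rewrite /coefs coef_poly /= -/u; ring.
apply: eq_big_nat => i /andP[i0 it]; rewrite /coefs coef_poly it -/u /sig_back.
(* For i > k the truncated difference [k - i] points at delay 0, but the signal factor is then 0. *)
case: ifPn => ik; last by rewrite !mulr0 addr0.
have kik : (k - i < k)%N by rewrite ltn_subrL i0 (leq_trans i0 ik).
rewrite (nth_map (0, 0, 0)) ?size_hist// nth_hist// -[(st _).1.2]/(u (k - i)%N).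
ring.
Qed.

(** Eliminating y gives aP aK u = aP bK y = bP bK e; adding bP bK H u to both sides closes the loop,
    since e + H u = v - d. *)
Lemma loop_convolution : conv (coefs (G_den tau alpha p bP aP bK aK)) u =
  conv (coefs (G_num bP bK)) (fun k => v k - dd k).
Proof.
have ->: (fun k => v k - dd k) = (fun k => e k + conv (coefs (Hpoly tau alpha p)) u k).
  by apply/funext => k; rewrite channel; ring.
rewrite convDr /G_den /G_num.
have cD (q q' : {poly R}) : coefs (q + q') = fun k => coefs q k + coefs q' k.
  by apply/funext => k; rewrite /coefs coefD.
apply/funext => k; rewrite cD convDl; congr (_ + _); last first.
  by rewrite -conv_coefs -convA.
rewrite -conv_coefs -convA controller (mulrC bP) -conv_coefs -[in RHS]convA -plant !convA.
by rewrite (convC (coefs bK)).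
Qed.

End Signals.
End Loop.

Section LoopRecursion.
Variable R : realType.
Variables (bP aP bK aK : {poly R}) (tau : nat) (alpha p : nat -> R).

Definition chan_dev (t : nat) : {poly R} := (alpha t)%:P * 'X^t - Hpoly tau alpha p.

Lemma coef_chan_dev t i : (t <= tau)%N -> (chan_dev t)`_i =
  if (i <= tau)%N then alpha i * ((t == i)%:R - p i) else 0.
Proof.
move=> tle; rewrite coefB coefCM coefXn coef_poly ltnS eq_sym.
case: ifPn => it; first by case: eqP => [->|_] /=; ring.
have /negbTE -> : t != i by apply: contraNneq it => <-.
by rewrite mulr0 subr0.
Qed.

Lemma sum_chan_dev i : \sum_(t < tau.+1) p t = 1 ->
  \sum_(t < tau.+1) p t * (chan_dev t)`_i = 0.
Proof.
move=> p1; rewrite (eq_bigr (fun t : 'I_tau.+1 =>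
  (if (i <= tau)%N then alpha i else 0) * ((p t * (t == i :> nat)%:R) - p t * p i))); last first.
  by move=> t _; rewrite coef_chan_dev -1?ltnS//; case: ifP => _; ring.
rewrite -mulr_sumr sumrB -mulr_suml p1 mul1r.
case: ifPn => it; last by rewrite mul0r.
have it1 : (i < tau.+1)%N by [].
rewrite (bigD1 (Ordinal it1))//= eqxx big1 ?addr0 ?mulr1 ?subrr ?mulr0// => t.
by rewrite -val_eqE /= => /negbTE ->; rewrite mulr0.
Qed.

Section Signals.
Variables (v : nat -> R) (del : nat -> nat) (g : nat -> R).
Hypothesis del_le : forall n, (del n <= tau)%N.
Hypotheses (bP0 : bP`_0 = 0) (aP0 : aP`_0 = 1) (aK0 : aK`_0 = 1).
Hypothesis gE : conv (coefs (G_den tau alpha p bP aP bK aK)) g = coefs (G_num bP bK).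

Let u := cl_u bP aP bK aK tau alpha v del.

Let sum_del n (f : nat -> R) : \sum_(t < tau.+1) (del n == t)%:R * f t = f (del n).
Proof. exact: sum_select. Qed.

(** The samples sent with delay t all pass through the fixed filter [chan_dev t]. Grouping them by
    delay turns the time-varying channel into genuine convolutions, which associate with g. *)
Let cl_d_conv : cl_d bP aP bK aK tau alpha v del p =
  fun k => \sum_(t < tau.+1) conv (coefs (chan_dev t)) (fun n => (del n == t)%:R * u n) k.
Proof.
apply/funext => k; rewrite /conv exchange_big /=.
rewrite (eq_bigr (fun i : 'I_k.+1 => (chan_dev (del (k - i)%N))`_i * u (k - i)%N)); last first.
  move=> i _; rewrite -(sum_del (k - i)%N (fun t => (chan_dev t)`_i * u (k - i)%N)).
  by apply: eq_bigr => t _; rewrite /coefs mulrCA.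
rewrite -[RHS]/(conv (fun i => (chan_dev (del (k - i)%N))`_i) u k).
rewrite -(@sum_delayed_conv _ tau.+1); last first.
  by move=> i ti; rewrite coef_chan_dev// leqNgt ti.
rewrite /cl_d; apply: eq_big_nat => i /andP[_]; rewrite ltnS => it.
by rewrite coef_chan_dev// it.
Qed.

Lemma G_den0 : (G_den tau alpha p bP aP bK aK)`_0 = 1.
Proof. by rewrite /G_den coefD !coef0M aP0 aK0 bP0 !mul0r addr0 mulr1. Qed.

Lemma response0 : g 0%N = 0.
Proof.
have := congr1 (fun f => f 0%N) gE; rewrite /conv big_ord1 /coefs G_den0 mul1r subnn.
by move=> ->; rewrite coef0M bP0 mul0r.
Qed.

Lemma loop_recursion k : u k = conv g v k -
  \sum_(n < k) conv g (coefs (chan_dev (del n))) (k - n)%N * u n.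
Proof.
have uE : u = conv g (fun k => v k - cl_d bP aP bK aK tau alpha v del p k).
  apply: (conv_cancel (a := coefs (G_den tau alpha p bP aP bK aK))); first exact: G_den0.
  by rewrite loop_convolution// convA gE.
rewrite {1}uE convBr; congr (_ - _).
rewrite cl_d_conv conv_sumr.
rewrite (eq_bigr (fun t : 'I_tau.+1 => \sum_(n < k.+1)
   (del n == t)%:R * (conv g (coefs (chan_dev t)) (k - n)%N * u n))); last first.
  by move=> t _; rewrite convA conv_rev; apply: eq_bigr => n _; rewrite mulrCA.
rewrite exchange_big /= (eq_bigr (fun n : 'I_k.+1 =>
   conv g (coefs (chan_dev (del n))) (k - n)%N * u n)); last first.
  by move=> n _; rewrite (sum_del n (fun t => conv g (coefs (chan_dev t)) (k - n)%N * u n)).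
(* The term n = k carries the factor g(0) = 0, so only delays strictly before k remain. *)
by rewrite big_ord_recr /= subnn /conv big_ord1 response0 !mul0r addr0.
Qed.

End Signals.
End LoopRecursion.

(** * Second moments of the response to random delays *)

Section RandomResponse.
Context {R : realType}.
Variables (tau : nat) (p : nat -> R) (c : nat -> nat -> R).
Hypothesis p1 : \sum_(t < tau.+1) p t = 1.
Hypothesis c_mean : forall m, \sum_(t < tau.+1) p t * c t m = 0.

Let s m := \sum_(t < tau.+1) p t * c t m ^+ 2.

Variables (a : nat -> R) (W : (nat -> nat) -> nat -> R).
Hypothesis WE : forall D k, W D k = a k - \sum_(n < k) c (D n) (k - n)%N * W D n.

Lemma depends_below_response k : depends_below k (W^~ k).
Proof.
elim/ltn_ind: k => k ih D D' DD; rewrite !WE; congr (_ - _); apply: eq_bigr => n _.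
by rewrite DD// (ih n _ D D')// => i ik; apply: DD; exact: ltn_trans (ltn_ord n).
Qed.

Lemma response_causal j : (forall i, (i < j)%N -> a i = 0) ->
  forall D k, (k < j)%N -> W D k = 0.
Proof.
move=> a0 D; elim/ltn_ind => k ih kj; rewrite WE a0// big1 ?subr0// => n _.
by rewrite ih ?mulr0// (ltn_trans _ kj).
Qed.

(** The sum defining W(k) is revealed one term at a time. The partial sum [Z M] and [W D M] depend
    on delays below [M] only, so the term carrying delay [M] is orthogonal to [Z M] and the squares
    add up. *)
Lemma delay_mean_response_sq k : delay_mean tau p k (fun D => W D k ^+ 2) =
  a k ^+ 2 + \sum_(n < k) s (k - n)%N * delay_mean tau p n (fun D => W D n ^+ 2).
Proof.
pose Z M (D : nat -> nat) := a k - \sum_(n < M) c (D n) (k - n)%N * W D n.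
have depends_belowZ M : depends_below M (Z M).
  move=> D D' DD; congr (_ - _); apply: eq_bigr => n _.
  by rewrite DD// (depends_below_response (D' := D'))// => i ik; apply: DD; exact: ltn_trans (ltn_ord n).
suff H M : delay_mean tau p M (fun D => Z M D ^+ 2) =
    a k ^+ 2 + \sum_(n < M) s (k - n)%N * delay_mean tau p n (fun D => W D n ^+ 2).
  by rewrite -H; apply: eq_delay_mean => D; rewrite WE.
elim: M => [|M ih]; first by rewrite /= /Z !big_ord0 subr0 addr0.
have -> : \sum_(n < M.+1) s (k - n)%N * delay_mean tau p n (fun D => W D n ^+ 2) =
    \sum_(n < M) s (k - n)%N * delay_mean tau p n (fun D => W D n ^+ 2) +
    s (k - M)%N * delay_mean tau p M (fun D => W D M ^+ 2) by rewrite big_ord_recr.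
rewrite addrA -ih -[delay_mean tau p M (fun D => Z M D ^+ 2)](delay_mean_below p1 (N := M.+1))//; last first.
  by move=> D D' DD; rewrite (depends_belowZ _ D D').
rewrite -[X in _ = _ + X](delay_mean_last tau p (fun t => c t (k - M)%N ^+ 2)); last first.
  by move=> D D' DD; rewrite (depends_below_response DD).
(* The zero added here is the cross term: the mean of c at lag k - M, which vanishes, times that of
   2 Z W. *)
rewrite -[LHS]addr0 -[X in _ + X](mul0r (delay_mean tau p M (fun D => 2 * (Z M D * W D M)))).
rewrite -[X in X * _](c_mean (k - M)%N) -(delay_mean_last tau p (fun t => c t (k - M)%N)); last first.
  by move=> D D' DD; rewrite (depends_below_response DD) (depends_belowZ _ D D').
rewrite -!delay_meanD; apply: eq_delay_mean => D.
by rewrite /Z big_ord_recr /=; ring.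
Qed.

End RandomResponse.

Section SecondMoment.
Context {R : realType} {d : measure_display} {T : measurableType d}.
Variables (P : probability T R) (tau : nat) (p : nat -> R).
Variables (del : nat -> T -> nat) (v : nat -> T -> R) (sv : nat -> R).
Hypothesis p1 : \sum_(t < tau.+1) p t = 1.
Hypothesis delP : delay_process P tau p del.
Hypothesis v_indep : mutual_indep P (fun k => events_real (v k)).
Hypothesis v_del : indep_families P (fun k => events_real (v k)) (fun n => events_nat (del n)).
Hypothesis v_mean : forall k, has_mean P (v k) 0.
Hypothesis v_var : forall k, has_mean P (fun w => v k w ^+ 2) (sv k).
Variables (c : nat -> nat -> R) (g : nat -> R) (U : T -> nat -> R).
Hypothesis c_mean : forall m, \sum_(t < tau.+1) p t * c t m = 0.
Hypothesis UE : forall w k, U w k = conv g (v^~ w) k -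
  \sum_(n < k) c (del n w) (k - n)%N * U w n.

(** By superposition U is the sum of v_j W_j, where W_j answers a unit pulse at time j and depends
    on the delays alone. In the square only the diagonal products of noise values survive, so x(k)
    is the sum of sv(j) times the mean of W_j(k)^2. *)
Lemma second_moment_recursion : exists x : nat -> R,
  (forall k, has_mean P (fun w => U w k ^+ 2) (x k)) /\
  forall k, x k = conv (fun i => g i ^+ 2) sv k +
    \sum_(n < k) (\sum_(t < tau.+1) p t * c t (k - n)%N ^+ 2) * x n.
Proof.
pose a j k := conv g (unit_pulse j) k.
have [W WE] : exists W : nat -> (nat -> nat) -> nat -> R, forall j D k,
    W j D k = a j k - \sum_(n < k) c (D n) (k - n)%N * W j D n.
  have /choice[W WE] : forall jD : nat * (nat -> nat), exists W : nat -> R,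
      forall k, W k = a jD.1 k - \sum_(n < k) c (jD.2 n) (k - n)%N * W n.
    move=> [j D] /=; have [W WE] := exists_recursive (fun k h =>
      a j k - \sum_(n < k) c (D n) (k - n)%N * h n).
    exists W => k; rewrite WE; congr (_ - _); apply: eq_bigr => n _.
    by rewrite ltn_ord.
  by exists (fun j D => W (j, D)) => j D k; exact: (WE (j, D)).
have W0 j D k : (k < j)%N -> W j D k = 0.
  have aj0 i : (i < j)%N -> a j i = 0 by move=> ij; rewrite /a conv_pulse leqNgt ij.
  exact: (response_causal (WE j) aj0).
have UW w K k : (k < K)%N -> U w k = \sum_(j < K) v j w * W j (del^~ w) k.
  elim/ltn_ind: k => k ih kK; rewrite UE.
  rewrite (eq_bigr (fun n : 'I_k => \sum_(j < K) v j w *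
      (c (del n w) (k - n)%N * W j (del^~ w) n))); last first.
    move=> n _; rewrite ih// ?(ltn_trans _ kK)// mulr_sumr.
    by apply: eq_bigr => j _; rewrite mulrCA.
  rewrite exchange_big /=.
  have -> : conv g (v^~ w) k = \sum_(j < K) v j w * a j k.
    rewrite -(big_mkord xpredT (fun j => v j w * a j k)) (@big_cat_nat _ _ _ k.+1)//=.
    rewrite [X in _ + X]big_nat_cond [X in _ + X]big1 ?addr0; last first.
      move=> j /andP[/andP[kj _] _]; rewrite /a conv_pulse leqNgt kj mulr0//.
    rewrite big_mkord conv_rev; apply: eq_bigr => j _.
    by rewrite /a conv_pulse -ltnS ltn_ord mulrC.
  rewrite -sumrB; apply: eq_bigr => j _.
  by rewrite WE mulrBr; congr (_ - _); rewrite mulr_sumr.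
pose ew j k := delay_mean tau p k (fun D => W j D k ^+ 2).
pose x k := \sum_(j < k.+1) ew j k * sv j.
have ew0 j k : (k < j)%N -> ew j k = 0.
  move=> kj; rewrite -[RHS](delay_mean0 tau p k); apply: eq_delay_mean => D.
  by rewrite W0// expr0n.
exists x; split => [k|k].
  pose f (ij : 'I_k.+1 * 'I_k.+1) w :=
    (W ij.1 (del^~ w) k * W ij.2 (del^~ w) k) * (v ij.1 w * v ij.2 w).
  have fE ij : has_mean P (f ij) (delay_mean tau p k (fun D => W ij.1 D k * W ij.2 D k) *
      ((ij.1 == ij.2 :> nat)%:R * sv ij.1)).
    apply: (has_mean_noise_functional delP v_indep v_del v_mean v_var
      (F := fun D => W ij.1 D k * W ij.2 D k)) => D D' DD.
    by rewrite (depends_below_response (WE ij.1) DD) (depends_below_response (WE ij.2) DD).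
  have xE : x k = \sum_ij delay_mean tau p k (fun D => W (ij : 'I_k.+1 * 'I_k.+1).1 D k * W ij.2 D k) *
      ((ij.1 == ij.2 :> nat)%:R * sv ij.1).
    rewrite -(pair_bigA _ (fun i j : 'I_k.+1 => delay_mean tau p k (fun D => W i D k * W j D k) *
      ((i == j :> nat)%:R * sv i))) /=; apply: eq_bigr => i _.
    rewrite (bigD1 i)//= eqxx mul1r big1 ?addr0// => j.
    by rewrite eq_sym -val_eqE => /negbTE /= ->; rewrite mul0r mulr0.
  rewrite xE; apply: eq_has_mean (has_mean_sum _ fE) => w.
  rewrite (UW w k.+1 k)// expr2 big_distrlr /= pair_bigA /=.
  by apply: eq_bigr => ij _; rewrite /f; ring.
(* Causality lets all x(n) with n <= k share one range of j, so that the sums over j and n can be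
   exchanged. *)
have xK K n : (n < K)%N -> x n = \sum_(j < K) ew j n * sv j.
  move=> nK; rewrite -(big_mkord xpredT (fun j => ew j n * sv j)).
  rewrite (@big_cat_nat _ _ _ n.+1)//= big_mkord.
  rewrite [X in _ + X]big_nat_cond [X in _ + X]big1 ?addr0// => j /andP[/andP[nj _] _].
  by rewrite ew0// mul0r.
rewrite [LHS](xK k.+1)// (eq_bigr (fun j : 'I_k.+1 => a j k ^+ 2 * sv j +
  \sum_(n < k) (\sum_(t < tau.+1) p t * c t (k - n)%N ^+ 2) * (ew j n * sv j))); last first.
  move=> j _; rewrite {1}/ew (delay_mean_response_sq p1 c_mean (WE j)) mulrDl; congr (_ + _).
  by rewrite mulr_suml; apply: eq_bigr => n _; rewrite mulrA.
rewrite big_split /= exchange_big /=; congr (_ + _).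
  by rewrite conv_rev; apply: eq_bigr => j _; rewrite /a conv_pulse -ltnS ltn_ord.
by apply: eq_bigr => n _; rewrite -mulr_sumr (xK k.+1)// ltnW// ltnS.
Qed.

End SecondMoment.

(** * Renewal equations *)

Section Renewal.
Context {R : realType}.
Implicit Types (f g s r a b x : nat -> R).

(** Partial sums are kept as convolutions with 1 so that associativity applies to them. *)
Lemma conv1E f k : conv f (fun=> 1) k = \sum_(i < k.+1) f i.
Proof. by apply: eq_bigr => i _; rewrite mulr1. Qed.

Lemma conv_ge0 f g : (forall i, 0 <= f i) -> (forall i, 0 <= g i) ->
  forall k, 0 <= conv f g k.
Proof. by move=> f0 g0 k; apply: sumr_ge0 => i _; exact: mulr_ge0. Qed.

Lemma conv1_nondecreasing f : (forall i, 0 <= f i) ->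
  nondecreasing_seq (conv f (fun=> 1)).
Proof.
move=> f0; apply/nondecreasing_seqP => n.
by rewrite !conv1E [leRHS]big_ord_recr /= lerDl.
Qed.

Lemma conv1_bounded_cvg f (M : R) : (forall i, 0 <= f i) ->
  (forall k, conv f (fun=> 1) k <= M) -> exists F : R, conv f (fun=> 1) @ \oo --> F.
Proof.
move=> f0 fM; exists (limn (conv f (fun=> 1))).
apply: nondecreasing_is_cvgn; first exact: conv1_nondecreasing.
by exists M => _ [k _ <-].
Qed.

Lemma conv1_le_lim f (F : R) : (forall i, 0 <= f i) ->
  conv f (fun=> 1) @ \oo --> F -> forall k, conv f (fun=> 1) k <= F.
Proof.
move=> f0 fF k; rewrite -(cvg_lim _ fF)//.
by apply: nondecreasing_cvgn_le; [exact: conv1_nondecreasing|apply/cvg_ex; exists F].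
Qed.

(** The sum is cut at a fixed index [N]: up to it the argument k - i is large and b is near [beta];
    beyond it b is bounded and the tail of f is small. *)
Lemma cvg_conv f b (F beta : R) : (forall i, 0 <= f i) ->
  conv f (fun=> 1) @ \oo --> F -> b @ \oo --> beta ->
  conv f b @ \oo --> F * beta.
Proof.
move=> f0 fF bb; have fleF := conv1_le_lim f0 fF.
have F0 : 0 <= F by apply: le_trans (fleF 0%N); exact: conv_ge0.
pose e n := `|b n - beta|.
have [M [M0 eM]] : exists M : R, 0 <= M /\ forall n, e n <= M.
  have [M [_ bM]] : bounded_fun b by apply: cvg_seq_bounded; apply/cvg_ex; exists beta.
  exists (`|M| + 1 + `|beta|); split; first by rewrite !addr_ge0.
  move=> n; apply: le_trans (ler_normB _ _) _; rewrite lerD2r.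
  by apply: bM => //; rewrite (le_lt_trans (ler_norm M))// ltrDl.
apply/cvgrPdist_le => eps eps0.
(* [F] weighs the head of the sum, [M] its tail, the norm of [beta] the defect of the partial sums
   of f, and 1 keeps the divisor positive. *)
pose C := F + M + `|beta| + 1.
have C0 : 0 < C by rewrite ltr_wpDl// !addr_ge0.
pose eps1 := eps / C.
have eps10 : 0 < eps1 by rewrite divr_gt0.
have /cvgrPdist_le/(_ _ eps10) [N _ HN] := fF.
have /cvgrPdist_le/(_ _ eps10) [K _ HK] := bb.
exists (N + K)%N => // k /= NKk.
have Nk : (N <= k)%N by apply: leq_trans NKk; exact: leq_addr.
have -> : conv f b k = conv f (fun n => b n - beta) k + beta * conv f (fun=> 1) k.
  have := congr1 (fun h => h k) (convDr f (fun n => b n - beta) (fun=> beta * 1)).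
  by rewrite convZr => <-; apply: eq_conv => // i _; ring.
have fe : `|conv f (fun n => b n - beta) k| <= eps1 * F + M * eps1.
  apply: (@le_trans _ _ (\sum_(i < k.+1) f i * e (k - i)%N)).
    apply: le_trans (ler_norm_sum _ _ _) _; apply: ler_sum => i _.
    by rewrite normrM (ger0_norm (f0 _)).
  apply: (@le_trans _ _ (\sum_(i < k.+1) (eps1 * f i + M * (f i * (N < i)%N%:R)))).
    apply: ler_sum => i _; case: ltnP => Ni /=.
      rewrite mulr1 mulrC; apply: ler_wpDl; first by rewrite mulr_ge0// ltW.
      exact: ler_wpM2r.
    rewrite mulr0 mulr0 addr0 mulrC; apply: ler_wpM2r => //.
    rewrite /e distrC; apply: HK => /=.
    have iKk : (i + K <= k)%N by apply: leq_trans NKk; rewrite leq_add2r.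
    by rewrite leq_subRL// (leq_trans (leq_addr K i)).
  rewrite big_split /= -!mulr_sumr; apply: lerD.
    by apply: ler_wpM2l; [exact: ltW|rewrite -conv1E].
  apply: ler_wpM2l => //.
  have -> : \sum_(i < k.+1) f i * (N < i)%N%:R = conv f (fun=> 1) k - conv f (fun=> 1) N.
    rewrite !conv1E -(big_mkord xpredT (fun i => f i * (N < i)%N%:R)) -!(big_mkord xpredT f).
    rewrite [LHS](@big_cat_nat _ _ _ N.+1)//=.
    rewrite [X in _ = X - _](@big_cat_nat _ _ _ N.+1)//= addrAC subrr add0r.
    rewrite big_nat_cond big1 ?add0r; last first.
      by move=> i /andP[/andP[_ iN] _]; rewrite ltnNge -ltnS iN mulr0.
    by apply: eq_big_nat => i /andP[-> _]; rewrite mulr1.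
  have := HN N (leqnn N); have := fleF k.
  by rewrite ler_norml => /= ? /andP[_ ?]; lra.
have HNk := HN k Nk.
have -> : F * beta - (conv f (fun n => b n - beta) k + beta * conv f (fun=> 1) k) =
  beta * (F - conv f (fun=> 1) k) - conv f (fun n => b n - beta) k by ring.
apply: le_trans (ler_normB _ _) _; rewrite normrM.
have -> : eps = `|beta| * eps1 + (eps1 * F + M * eps1) + eps1.
  by rewrite /eps1 /C; field; rewrite gt_eqF.
apply: ler_wpDr; first exact: ltW.
by apply: lerD => //; apply: ler_wpM2l.
Qed.

(* Equivalently, [r] is the inverse of [1 - s] for convolution. *)
Definition renewal s r : Prop := r = fun k => unit_pulse 0 k + conv s r k.

Lemma conv_unitl f : conv (unit_pulse 0) f = f.
Proof. by apply/funext => k; rewrite convC conv_pulse leq0n subn0. Qed.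

Lemma exists_renewal s : s 0%N = 0 -> exists r, renewal s r.
Proof.
move=> s0; have [|r rE] := @conv_solve _ (fun k => unit_pulse 0 k - s k) (unit_pulse 0).
  by rewrite s0 subr0.
exists r; apply/funext => k; have := congr1 (fun h => h k) rE.
rewrite convC convBr convC conv_unitl (convC r) => <-; ring.
Qed.

(** Both sequences solve the equation with operator 1 - s and right-hand side [a], and 1 - s can be
    cancelled. *)
Lemma renewal_solution s r a x : s 0%N = 0 -> renewal s r ->
  (forall k, x k = a k + conv s x k) -> x = conv r a.
Proof.
move=> s0 rr xE.
apply: (@conv_cancel _ (fun k => unit_pulse 0 k - s k)); first by rewrite s0 subr0.
have E y : conv (fun k => unit_pulse 0 k - s k) y = fun k => y k - conv s y k.
  by rewrite convC convBr convC conv_unitl (convC y).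
rewrite E convA E (_ : (fun k => r k - conv s r k) = unit_pulse 0); last first.
  by apply/funext => k; rewrite {1}rr; ring.
by rewrite conv_unitl; apply/funext => k; rewrite {1}xE; ring.
Qed.

Section Sums.
Variables (s r : nat -> R).
Hypotheses (s_ge0 : forall i, 0 <= s i) (s0 : s 0%N = 0) (rr : renewal s r).

Lemma renewal_ge0 k : 0 <= r k.
Proof.
elim/ltn_ind: k => k ih; rewrite rr addr_ge0 ?ler0n//.
rewrite /conv big_ord_recl s0 mul0r add0r sumr_ge0// => i _.
by rewrite mulr_ge0// ih// ltn_subrL /= (leq_ltn_trans _ (ltn_ord i)).
Qed.

Lemma renewal0 : r 0%N = 1.
Proof. by rewrite rr /conv big_ord1 s0 mul0r addr0. Qed.

Lemma renewal_conv_ge b k : (forall i, 0 <= b i) -> b k <= conv r b k.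
Proof.
move=> b0; rewrite /conv big_ord_recl renewal0 mul1r subn0 lerDl sumr_ge0// => i _.
by rewrite mulr_ge0// renewal_ge0.
Qed.

(** The partial sums of r are 1 plus their own convolution with s. Being at least 1, they dominate
    the partial sums of s, which therefore converge; the limit reads Rs = 1 + S Rs. *)
Lemma renewal_sum (Rs : R) : conv r (fun=> 1) @ \oo --> Rs ->
  exists S : R, conv s (fun=> 1) @ \oo --> S /\ Rs * (1 - S) = 1.
Proof.
move=> rRs; have r_ge0 := renewal_ge0.
have E k : conv r (fun=> 1) k = 1 + conv s (conv r (fun=> 1)) k.
  rewrite convA {1}rr convDl; congr (_ + _).
  by rewrite convC conv_pulse.
have [k|S sS] := @conv1_bounded_cvg s Rs s_ge0.
  apply: (@le_trans _ _ (conv r (fun=> 1) k)); last exact: conv1_le_lim.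
  rewrite E; apply: ler_wpDl => //; apply: ler_sum => i _.
  apply: ler_wpM2l => //.
  by have := @renewal_conv_ge (fun=> 1) (k - i)%N (fun=> ler01).
exists S; split => //.
have H : conv r (fun=> 1) @ \oo --> 1 + S * Rs.
  have -> : conv r (fun=> 1) = fun k => 1 + conv s (conv r (fun=> 1)) k.
    by apply/funext.
  by apply: cvgD; [exact: cvg_cst|exact: cvg_conv].
have : Rs = 1 + S * Rs by exact: (cvg_unique _ rRs H).
lra.
Qed.

(** As r(0) = 1, the bound [M] passes to q times the partial sums of [a]. If a_j > 0, at time k + j
    every r(i) with i <= k is weighted by at least q a_j, which bounds the partial sums of r by M /
    (q a_j). *)
Lemma bounded_response_sums a (q M : R) : 0 < q -> (forall i, 0 <= a i) ->
  (forall k, conv r (conv a (fun=> q)) k <= M) ->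
  (exists A : R, conv a (fun=> 1) @ \oo --> A) /\
  ((exists j, a j != 0) -> exists Rs : R, conv r (fun=> 1) @ \oo --> Rs).
Proof.
move=> q0 a0 xM.
have aq : conv a (fun=> q) = fun k => q * conv a (fun=> 1) k.
  by rewrite -convZr mulr1.
split.
  apply: (@conv1_bounded_cvg _ (M / q)) => // k.
  rewrite ler_pdivlMr// mulrC; apply: le_trans (xM k).
  rewrite -[leLHS]/((fun k => q * conv a (fun=> 1) k) k) -aq.
  by apply: renewal_conv_ge => i; apply: conv_ge0 => // _; exact: ltW.
move=> [j aj]; have aj0 : 0 < a j by rewrite lt_neqAle eq_sym aj a0.
apply: (@conv1_bounded_cvg _ (M / (q * a j))) => [|k]; first exact: renewal_ge0.
rewrite ler_pdivlMr ?mulr_gt0//; apply: le_trans (xM (k + j)%N).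
have C0 i : 0 <= conv a (fun=> q) i by apply: conv_ge0 => // _; exact: ltW.
rewrite [leRHS]/conv -addSn big_split_ord /=; apply: ler_wpDr.
  by apply: sumr_ge0 => i _; rewrite mulr_ge0// renewal_ge0.
rewrite conv1E mulr_suml; apply: ler_sum => i _; apply: ler_wpM2l; first exact: renewal_ge0.
rewrite aq; apply: ler_wpM2l; first exact: ltW.
have jk : (j < (k + j - i).+1)%N by rewrite ltnS -addnBAC ?leq_addl// -ltnS.
rewrite conv1E (bigD1 (Ordinal jk))//= lerDl; exact: sumr_ge0.
Qed.

End Sums.
End Renewal.

(** * Integrals over the unit circle and Parseval's identity *)

Section CircleIntegral.
Variable R : realType.
Implicit Types (q : {poly R}) (th : R) (f g : R -> R).

Definition circle_int f : R := Rintegral lebesgue_measure `[(- pi)%R, pi] f.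

Let integrable_circle f : continuous f ->
  (@lebesgue_measure R).-integrable `[- pi, pi] (EFin \o f).
Proof.
move=> cf; apply: continuous_compact_integrable; first exact: segment_compact.
exact: continuous_subspaceT.
Qed.

Lemma circle_intD f g : continuous f -> continuous g ->
  circle_int (fun t => f t + g t) = circle_int f + circle_int g.
Proof. by move=> cf cg; rewrite /circle_int RintegralD//; exact: integrable_circle. Qed.

Lemma circle_intZ (c : R) f : continuous f ->
  circle_int (fun t => c * f t) = c * circle_int f.
Proof. by move=> cf; rewrite /circle_int RintegralZl//; exact: integrable_circle. Qed.

Lemma circle_int_cst (c : R) : circle_int (fun=> c) = c * (2 * pi).
Proof.
have mE : lebesgue_measure (`[(- pi)%R, pi]%classic : set R) = (2 * pi)%:E.
  rewrite lebesgue_measure_itv/= lte_fin ifT; last first.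
    by rewrite (@lt_trans _ _ 0)// ?oppr_lt0 pi_gt0.
  by rewrite -EFinB; congr EFin; ring.
rewrite /circle_int Rintegral_cst// -[RHS]/(c * fine (2 * pi)%:E).
by congr (_ * fine _); exact: mE.
Qed.

Lemma circle_int_dist f g (e : R) : continuous f -> continuous g ->
  (forall t, - pi <= t <= pi -> `|f t - g t| <= e) ->
  `|circle_int f - circle_int g| <= e * (2 * pi).
Proof.
move=> cf cg fg.
have cfg : continuous (fun t => f t - g t) by move=> t; apply: cvgB; [exact: cf|exact: cg].
rewrite /circle_int -RintegralB//; [|exact: integrable_circle..].
apply: le_trans (le_normr_Rintegral _ _) _ => //; first exact: integrable_circle.
have ie : (@lebesgue_measure R).-integrable `[- pi, pi] (EFin \o (fun=> e)).
  by apply: integrable_circle => t; exact: cvg_cst.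
have ifg : (@lebesgue_measure R).-integrable `[- pi, pi] (EFin \o (fun t => `|f t - g t|)).
  by apply: integrable_circle => t; apply: cvg_norm; exact: cfg.
rewrite -circle_int_cst; apply: (le_Rintegral _ ifg ie) => //; exact: fg.
Qed.

Lemma circle_int_cos n : circle_int (fun t => cos (n.+1%:R * t)) = 0.
Proof.
pose F (t : R) := n.+1%:R^-1 * sin (n.+1%:R * t).
have dF (t : R) : is_derive t 1 F (cos (n.+1%:R * t)).
  apply: is_derive_eq; rewrite /GRing.scale/=.
  by rewrite mulr1 mulrC -mulrA mulfV ?mulr1 ?pnatr_eq0.
have cc : continuous (fun t : R => cos (n.+1%:R * t)).
  move=> t; apply: (@cvg_comp _ _ _ (fun t : R => n.+1%:R * t)); last exact: continuous_cos.
  by apply: cvgM; [exact: cvg_cst|exact: cvg_id].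
have sin_npi m : sin (m%:R * pi) = 0 :> R.
  elim: m => [|m ih]; first by rewrite mul0r sin0.
  by rewrite -addn1 natrD mulrDl mul1r sinDpi ih oppr0.
rewrite /circle_int /Rintegral (@continuous_FTC2 _ _ F)//.
- by rewrite /F mulrN sinN sin_npi oppr0 mulr0 -EFinB subrr.
- by rewrite (@lt_trans _ _ 0)// ?oppr_lt0 pi_gt0.
- exact: continuous_subspaceT.
- have cF : continuous F by move=> t; apply: differentiable_continuous; apply/derivable1_diffP; case: (dF t).
  split; first by move=> t _; case: (dF t).
    by apply: cvg_at_right_filter; exact: cF.
  by apply: cvg_at_left_filter; exact: cF.
- by move=> t _; rewrite derive1E; case: (dF t).
Qed.

End CircleIntegral.

Section CirclePolynomials.
Variable R : realType.
Local Open Scope complex_scope.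
Implicit Types (q : {poly R}) (th : R) (z : R[i]).

Lemma ReM z z' : complex.Re (z * z') =
  complex.Re z * complex.Re z' - complex.Im z * complex.Im z'.
Proof. by case: z z' => [a b] [a' b']. Qed.

Lemma ImM z z' : complex.Im (z * z') =
  complex.Re z * complex.Im z' + complex.Im z * complex.Re z'.
Proof. by case: z z' => [a b] [a' b']. Qed.

Lemma ReD z z' : complex.Re (z + z') = complex.Re z + complex.Re z'.
Proof. by case: z z' => [a b] [a' b']. Qed.

Lemma ImD z z' : complex.Im (z + z') = complex.Im z + complex.Im z'.
Proof. by case: z z' => [a b] [a' b']. Qed.

Lemma sqnormM z z' : sqnorm (z * z') = sqnorm z * sqnorm z'.
Proof. by rewrite /sqnorm ReM ImM; ring. Qed.

Lemma sqnorm_ge0 z : 0 <= sqnorm z.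
Proof. by rewrite addr_ge0// sqr_ge0. Qed.

Lemma sqnorm_eq0 z : (sqnorm z == 0) = (z == 0).
Proof.
case: z => a b; rewrite /sqnorm/= paddr_eq0 ?sqr_ge0// !sqrf_eq0.
by rewrite eq_complex /=.
Qed.

Lemma sqnorm1 : sqnorm (1 : R[i]) = 1.
Proof. by rewrite /sqnorm /= expr1n expr0n addr0. Qed.

Lemma sqnormV z : sqnorm z^-1 = (sqnorm z)^-1.
Proof.
have [->|z0] := eqVneq z 0.
  have -> : sqnorm (0 : R[i]) = 0 by rewrite /sqnorm/= expr0n addr0.
  by rewrite !invr0 /sqnorm/= expr0n addr0.
have sz0 : sqnorm z != 0 by rewrite sqnorm_eq0.
by apply: (mulfI sz0); rewrite -sqnormM !mulfV// sqnorm1.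
Qed.

(** The value of z^-1, not of z, at angle [th]: transfer functions are fractions in z^-1. *)
Definition circ th : R[i] := Complex (cos th) (- sin th).

Lemma sqnorm_circ th : sqnorm (circ th) = 1.
Proof. by rewrite /sqnorm/= sqrrN cos2Dsin2. Qed.

Lemma circX th k : circ th ^+ k = Complex (cos (k%:R * th)) (- sin (k%:R * th)).
Proof.
elim: k => [|k ih]; first by rewrite mul0r cos0 sin0 oppr0.
rewrite exprS ih -addn1 natrD mulrDl mul1r cosD sinD.
by apply/eqP; rewrite eq_complex ReM ImM /=; apply/andP; split; apply/eqP; ring.
Qed.

Lemma toC_mulX q (c : R) : toC (q * 'X + c%:P) = toC q * 'X + (c%:C)%:P.
Proof. by rewrite /toC rmorphD rmorphM /= map_polyX map_polyC. Qed.

Lemma toCM q q' : toC (q * q') = toC q * toC q'.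
Proof. exact: rmorphM. Qed.

Lemma horner_toC_mulX q (c : R) z :
  (toC (q * 'X + c%:P)).[z] = z * (toC q).[z] + c%:C.
Proof. by rewrite toC_mulX hornerMXaddC mulrC. Qed.

Lemma continuous_circ q : continuous (fun th => complex.Re (toC q).[circ th]) /\
  continuous (fun th => complex.Im (toC q).[circ th]).
Proof.
elim/poly_ind: q => [|q c [cR cI]].
  rewrite /toC rmorph0; under eq_fun do rewrite horner0.
  by split; [move=> t; exact: cvg_cst|under eq_fun do rewrite horner0; move=> t; exact: cvg_cst].
split.
  under eq_fun do rewrite horner_toC_mulX ReD ReM /= mulNr opprK.
  move=> t; apply: cvgD; last exact: cvg_cst.
  by apply: cvgD; apply: cvgM; [exact: continuous_cos|exact: cR|exact: continuous_sin|exact: cI].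
under eq_fun do rewrite horner_toC_mulX ImD ImM /= addr0 mulNr.
move=> t; apply: cvgB; apply: cvgM; 
  [exact: continuous_cos|exact: cI|exact: continuous_sin|exact: cR].
Qed.

Lemma continuous_sqnorm_circ q : continuous (fun th => sqnorm (toC q).[circ th]).
Proof.
have [cR cI] := continuous_circ q.
move=> t; rewrite /sqnorm; under eq_fun do rewrite !expr2.
by apply: cvgD; apply: cvgM; first [exact: cR|exact: cI].
Qed.

Lemma continuous_Re_circX q k :
  continuous (fun th => complex.Re (circ th ^+ k * (toC q).[circ th])).
Proof.
have := (continuous_circ ('X^k * q)).1.
by under eq_fun do rewrite toCM /toC map_polyXn hornerM hornerXn.
Qed.

Lemma circle_int_Re_circX q k :
  circle_int (fun th => complex.Re (circ th ^+ k.+1 * (toC q).[circ th])) = 0.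
Proof.
elim/poly_ind: q k => [|q c ih] k.
  rewrite /toC rmorph0; under eq_fun do rewrite horner0 mulr0.
  by rewrite circle_int_cst mul0r.
have cc : continuous (fun th : R => complex.Re (circ th ^+ k.+1)).
  have := @continuous_Re_circX 1 k.+1.
  by under eq_fun do rewrite /toC rmorph1 hornerC mulr1.
transitivity (circle_int (fun th => complex.Re (circ th ^+ k.+2 * (toC q).[circ th]) +
    c * complex.Re (circ th ^+ k.+1))).
  congr circle_int; apply/funext => th.
  rewrite horner_toC_mulX mulrDr ReD mulrA -exprSr; congr (_ + _).
  by rewrite ReM /= mulr0 subr0 mulrC.
rewrite circle_intD ?ih ?add0r; last 2 first.
- exact: continuous_Re_circX.
- by move=> t; apply: cvgM; [exact: cvg_cst|exact: cc].
rewrite circle_intZ//; under eq_fun do rewrite circX /=.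
by rewrite circle_int_cos mulr0.
Qed.

(** Induction along Horner's scheme: |w q + c|^2 = |q|^2 + c^2 + 2 c Re(w q) for |w| = 1, and the
    last term has integral 0. *)
Lemma parseval_poly q N : (size q <= N)%N ->
  circle_int (fun th => sqnorm (toC q).[circ th]) = (2 * pi) * \sum_(i < N) q`_i ^+ 2.
Proof.
elim/poly_ind: q N => [|q c ih] N.
  move=> _; rewrite /toC rmorph0; under eq_fun do rewrite horner0 /sqnorm/= expr0n/= addr0.
  rewrite circle_int_cst mul0r big1 ?mulr0// => i _; by rewrite coef0 expr0n.
have coefS i : (q * 'X + c%:P)`_i.+1 = q`_i by rewrite coefD coefMX coefC addr0.
have coef0' : (q * 'X + c%:P)`_0 = c by rewrite coefD coefMX coefC add0r.
case: N => [|N].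
  rewrite size_poly_leq0 => /eqP ->; rewrite /toC rmorph0.
  under eq_fun do rewrite horner0 /sqnorm/= expr0n/= addr0.
  by rewrite circle_int_cst mul0r big_ord0 mulr0.
move=> /leq_sizeP qN; have sq : (size q <= N)%N.
  by apply/leq_sizeP => j Nj; rewrite -coefS qN.
rewrite big_ord_recl coef0' (eq_bigr (fun i : 'I_N => q`_i ^+ 2)); last first.
  by move=> i _; rewrite coefS.
transitivity (circle_int (fun th => sqnorm (toC q).[circ th] +
    (c ^+ 2 + 2 * c * complex.Re (circ th ^+ 1 * (toC q).[circ th])))).
  congr circle_int; apply/funext => th; rewrite horner_toC_mulX expr1.
  have <- : sqnorm (circ th * (toC q).[circ th]) = sqnorm (toC q).[circ th].
    by rewrite sqnormM sqnorm_circ mul1r.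
  by rewrite /sqnorm ReD ImD /=; ring.
have c1 : continuous (fun th => 2 * c * complex.Re (circ th ^+ 1 * (toC q).[circ th])).
  by move=> t; apply: cvgM; [exact: cvg_cst|exact: continuous_Re_circX].
rewrite circle_intD; last 2 first.
- exact: continuous_sqnorm_circ.
- by move=> t; apply: cvgD; [exact: cvg_cst|exact: c1].
rewrite (circle_intD (f := fun=> c ^+ 2) _ c1); last exact: cst_continuous.
rewrite (circle_intZ (2 * c) (@continuous_Re_circX q 1)).
rewrite circle_int_Re_circX circle_int_cst (ih N sq); ring.
Qed.

Lemma Re_Im_circ_le q th N : (size q <= N)%N ->
  `|complex.Re (toC q).[circ th]| <= \sum_(i < N) `|q`_i| /\
  `|complex.Im (toC q).[circ th]| <= \sum_(i < N) `|q`_i|.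
Proof.
move=> qN; rewrite /toC (horner_coef_wide _ (n := N)); last by rewrite size_map_poly.
elim: N {qN} => [|N [ihR ihI]]; first by rewrite !big_ord0 /= normr0.
have n1 : `|cos (N%:R * th)| <= 1 /\ `|sin (N%:R * th)| <= 1.
  by split; rewrite ler_norml ?cos_geN1 ?cos_le1 ?sin_geN1 ?sin_le1.
rewrite !big_ord_recr /= coef_map circX ReD ImD ReM ImM /= !mul0r subr0 addr0.
split; (apply: le_trans (ler_normD _ _) _; apply: lerD => //; rewrite normrM ?normrN).
  by rewrite ler_piMr//; case: n1.
by rewrite ler_piMr//; case: n1.
Qed.

End CirclePolynomials.

Section Parseval.
Variable R : realType.
Variables (n d : {poly R}) (g : nat -> R).
Hypothesis d_neq0 : forall th : R, (toC d).[circ th] != 0.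

Definition sqratio (th : R) : R := sqnorm (toC n).[circ th] / sqnorm (toC d).[circ th].

Let d_gt0 th : 0 < sqnorm (toC d).[circ th].
Proof. by rewrite lt_neqAle sqnorm_ge0 eq_sym sqnorm_eq0 d_neq0. Qed.

Lemma continuous_sqratio : continuous sqratio.
Proof.
move=> t; apply: cvgM; first exact: continuous_sqnorm_circ.
apply: cvgV; last exact: continuous_sqnorm_circ.
by rewrite gt_eqF.
Qed.

Hypotheses (gE : conv (coefs d) g = coefs n) (g0 : g @ \oo --> (0 : R)).

Let G N : {poly R} := \poly_(i < N.+1) g i.
(** The residual of the truncated series. For large [N] it has at most [size d] nonzero
    coefficients, just after index [N], each controlled by the tail of g; so decay of g alone makes
    it uniformly small on the circle. *)
Let e N := d * G N - n.
Let Bd := \sum_(j < size d) `|d`_j|.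
Let Bn := \sum_(j < size n) `|n`_j|.
Let K := (size d)%:R * Bd.

Let coef_e N i : (e N)`_i = \sum_(j < i.+1) d`_j * ((G N)`_(i - j) - g (i - j)%N).
Proof.
rewrite coefB coefM -[n`_i]/(coefs n i) -gE -sumrB.
by apply: eq_bigr => j _; rewrite mulrBr.
Qed.

Let coef_e_le N i (eta : R) : 0 <= eta -> (forall m, (N < m)%N -> `|g m| <= eta) ->
  `|(e N)`_i| <= Bd * eta.
Proof.
move=> eta0 geta; rewrite coef_e.
apply: le_trans (ler_norm_sum _ _ _) _.
apply: (@le_trans _ _ (\sum_(j < i.+1) `|d`_j| * eta)).
  apply: ler_sum => j _; rewrite normrM; apply: ler_wpM2l => //.
  rewrite coef_poly ltnS; case: leqP => ij; first by rewrite subrr normr0.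
  by rewrite sub0r normrN; exact: geta.
rewrite -mulr_suml; apply: ler_wpM2r => //.
rewrite -(@conv1E _ (fun j => `|d`_j|)) -(@sum_delayed_conv _ (size d)); last first.
  by move=> j dj; rewrite nth_default// normr0.
rewrite /Bd -(big_mkord xpredT (fun j => `|d`_j|)); apply: ler_sum => j _.
by case: ifP => _; rewrite ?mulr1 ?mulr0.
Qed.

Let e_low N i : (i <= N)%N -> (e N)`_i = 0.
Proof.
move=> iN; rewrite coef_e big1// => j _.
by rewrite coef_poly ltnS (leq_trans (leq_subr _ _))// subrr mulr0.
Qed.

Let size_e N : (size n <= N)%N -> (size (e N) <= N.+1 + size d)%N.
Proof.
move=> nN; apply: leq_trans (size_polyD _ _) _; rewrite size_polyN geq_max.
apply/andP; split; last by rewrite (leq_trans nN)// addSn (leq_trans (leqnSn _))// ltnS leq_addr.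
apply: leq_trans (size_polyMleq _ _) _; rewrite addnC.
apply: leq_trans (leq_pred _) _; rewrite leq_add2r; exact: size_poly.
Qed.

Let e_circ N th (eta : R) : 0 <= eta -> (size n <= N)%N ->
  (forall m, (N < m)%N -> `|g m| <= eta) ->
  `|complex.Re (toC (e N)).[circ th]| <= K * eta /\
  `|complex.Im (toC (e N)).[circ th]| <= K * eta.
Proof.
move=> eta0 nN geta.
suff H : \sum_(i < N.+1 + size d) `|(e N)`_i| <= K * eta.
  have [hR hI] := Re_Im_circ_le th (size_e nN).
  by split; [exact: le_trans hR H|exact: le_trans hI H].
rewrite big_split_ord /= big1 ?add0r; last by move=> i _; rewrite e_low ?normr0// -ltnS.
apply: le_trans (ler_sum _ (fun i _ => coef_e_le _ eta0 geta)) _.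
by rewrite sumr_const card_ord /K -mulrA mulr_natl.
Qed.

Let circle_int_G N : circle_int (fun th => sqnorm (toC (G N)).[circ th]) =
  (2 * pi) * conv (fun i => g i ^+ 2) (fun=> 1) N.
Proof.
rewrite (@parseval_poly _ _ N.+1) ?size_poly// conv1E; congr (_ * _).
by apply: eq_bigr => i _; rewrite coef_poly ltn_ord.
Qed.

Let d_min : exists2 m : R, 0 < m &
  forall th, - pi <= th <= pi -> m <= sqnorm (toC d).[circ th].
Proof.
have pi_le : - pi <= pi :> R by rewrite ge0_cp// pi_ge0.
have [|c _ cmin] := @EVT_min R (fun th => sqnorm (toC d).[circ th]) (- pi) pi pi_le.
  by apply: continuous_subspaceT; exact: continuous_sqnorm_circ.
by exists (sqnorm (toC d).[circ c]) => // th thpi; apply: cmin; rewrite in_itv.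
Qed.

(** Since d G_N = n + e_N, the difference |G_N|^2 - |n/d|^2 equals (|n + e_N|^2 - |n|^2) / |d|^2,
    uniformly small because |d|^2 has a positive minimum; the integral of |G_N|^2 is 2 pi times a
    partial sum. *)
Lemma parseval : conv (fun i => g i ^+ 2) (fun=> 1) @ \oo -->
  (2 * pi)^-1 * circle_int sqratio.
Proof.
have [m m0 mle] := d_min.
(* Bounds |n + e|^2 - |n|^2 by C eta: two cross terms of at most 2 Bn K eta, and two squares of at
   most K^2 eta^2 <= K^2 eta, as eta <= 1. *)
pose C := 4 * Bn * K + 2 * K ^+ 2.
have Bn0 : 0 <= Bn by apply: sumr_ge0.
have K0 : 0 <= K by rewrite mulr_ge0// sumr_ge0.
have C0 : 0 <= C.
  apply: addr_ge0; first by apply: mulr_ge0 => //; exact: mulr_ge0.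
  by rewrite mulr_ge0// exprn_ge0.
apply/cvgrPdist_le => eps eps0.
pose eta := Num.min 1 (eps * m / (C + 1)).
have C1 : 0 < C + 1 by rewrite ltr_wpDl.
have eta0 : 0 < eta by rewrite lt_min ltr01 divr_gt0// mulr_gt0.
have eta1 : eta <= 1 by rewrite ge_min lexx.
have etaC : C * eta <= eps * m.
  have : (C + 1) * eta <= eps * m.
    by rewrite mulrC -ler_pdivlMr// ge_min lexx orbT.
  by apply: le_trans; rewrite ler_wpM2r ?lerDl// ltW.
have /cvgrPdist_le/(_ _ eta0) [N0 _ HN0] := g0.
exists (maxn N0 (size n)) => // N; rewrite /= geq_max => /andP[N0N nN].
have geta k : (N < k)%N -> `|g k| <= eta.
  move=> Nk; have := HN0 k (leq_trans N0N (ltnW Nk)).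
  by rewrite sub0r normrN.
have pi20 : 0 < 2 * pi :> R by rewrite mulr_gt0// pi_gt0.
have -> : conv (fun i => g i ^+ 2) (fun=> 1) N =
    (2 * pi)^-1 * circle_int (fun th => sqnorm (toC (G N)).[circ th]).
  by rewrite circle_int_G mulrA mulVf ?mul1r// gt_eqF.
rewrite -mulrBr normrM gtr0_norm ?invr_gt0// mulrC ler_pdivrMr// distrC.
apply: circle_int_dist; [exact: continuous_sqnorm_circ|exact: continuous_sqratio|].
move=> th thpi.
pose z := (toC n).[circ th]; pose w := (toC (e N)).[circ th].
have dG : (toC d).[circ th] * (toC (G N)).[circ th] = z + w.
  by rewrite /z /w -hornerM -hornerD -toCM /toC -rmorphD /e addrC subrK.
have -> : sqnorm (toC (G N)).[circ th] - sqratio th =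
    (sqnorm (z + w) - sqnorm z) / sqnorm (toC d).[circ th].
  rewrite mulrBl; congr (_ - _).
  by rewrite -dG sqnormM mulrAC mulfV ?mul1r// gt_eqF.
rewrite normrM normfV (gtr0_norm (d_gt0 th)) ler_pdivrMr//.
apply: (@le_trans _ _ (eps * m)); last by rewrite ler_wpM2l ?mle// ltW.
apply: le_trans etaC.
have [wR wI] := e_circ th (ltW eta0) nN geta.
have [zR zI] := Re_Im_circ_le th (leqnn (size n)).
have -> : sqnorm (z + w) - sqnorm z = 2 * complex.Re z * complex.Re w +
    2 * complex.Im z * complex.Im w + (complex.Re w ^+ 2 + complex.Im w ^+ 2).
  by rewrite /sqnorm ReD ImD; ring.
have M2 (a b : R) : `|a| <= Bn -> `|b| <= K * eta -> `|2 * a * b| <= 2 * Bn * (K * eta).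
  by move=> aB bK; rewrite !normrM ger0_norm// ler_pM// ?ler_wpM2l// mulr_ge0.
have S2 (b : R) : `|b| <= K * eta -> `|b ^+ 2| <= K ^+ 2 * eta.
  move=> bK; rewrite normrX; apply: (@le_trans _ _ ((K * eta) ^+ 2)).
    by rewrite lerXn2r// nnegrE mulr_ge0// ltW.
  by rewrite exprMn ler_wpM2l ?sqr_ge0// expr2 ler_piMl// ltW.
apply: le_trans (ler_normD _ _) _.
have -> : C * eta = (2 * Bn * (K * eta) + 2 * Bn * (K * eta)) + (K ^+ 2 * eta + K ^+ 2 * eta).
  by rewrite /C; ring.
by apply: lerD; apply: le_trans (ler_normD _ _) _; apply: lerD; first [exact: M2|exact: S2].
Qed.

End Parseval.

(** * Squared H2 norms of the loop *)

Section HtwoNorm.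
Variable R : realType.
Local Open Scope complex_scope.

Lemma Rintegral_eq_off_seq (D : set R) (f g : R -> R) (N : seq R) :
  measurable D -> measurable_fun D g ->
  (forall x, D x -> x \notin N -> f x = g x) ->
  Rintegral lebesgue_measure D f = Rintegral lebesgue_measure D g.
Proof.
move=> mD mg fg.
(* Measurability of [f] is not assumed; it follows from writing [f] as [g] corrected at finitely
   many points. *)
pose h x := g x + \sum_(r <- undup N) (f r - g r) * \1_[set r] x.
have fh x : D x -> f x = h x.
  move=> Dx; rewrite /h; have [xN|xN] := boolP (x \in N).
    rewrite (bigD1_seq x) ?mem_undup ?undup_uniq//= indicE mem_set//= mulr1.
    rewrite big1 ?addr0 => [|r rx]; first by rewrite addrC subrK.
    by rewrite indicE memNset ?mulr0//= => /esym/eqP; rewrite (negbTE rx).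
  rewrite big_seq big1 ?addr0 ?fg// => r; rewrite mem_undup => rN.
  by rewrite indicE memNset ?mulr0//= => xr; move: xN; rewrite xr rN.
have mf : measurable_fun D f.
  apply: (eq_measurable_fun h) => [x /set_mem Dx|]; first by rewrite fh.
  apply: measurable_funD => //; apply: measurable_sum => r.
  by apply: measurable_funM; [exact: measurable_cst|exact: measurable_indic].
have cN : countable [set` N] by exact: finite_set_countable.
congr fine; apply: ae_eq_integral => //; [exact/measurable_EFinP|exact/measurable_EFinP|].
exists [set` N]; split.
- by apply: countable_measurable => //; exact: measurable_set1.
- exact: countable_lebesgue_measure0.
- move=> x /= nfg; apply: contrapT => /negP xN; apply: nfg => Dx.
  by rewrite fg.
Qed.

(** Each complex root on the circle determines its angle in [-pi, pi] up to sign, through [acos] of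
    its real part. *)
Lemma finite_circle_roots (q : {poly R}) : q != 0 -> exists N : seq R,
  forall th, - pi <= th <= pi -> th \notin N -> (toC q).[circ th] != 0.
Proof.
move=> q0; have tq0 : toC q != 0 by rewrite map_poly_eq0.
have [r rE] := closed_field_poly_normal (toC q).
exists ([seq acos (complex.Re z) | z <- r] ++ [seq - acos (complex.Re z) | z <- r]).
move=> th /andP[th1 th2]; apply: contra => qth.
have thr : circ th \in r.
  rewrite -root_prod_XsubC; move: qth; rewrite rE hornerZ mulf_eq0 lead_coef_eq0 (negbTE tq0) /=.
  by rewrite rootE.
rewrite mem_cat; have [th0|th0] := leP 0 th; apply/orP; [left|right].
  apply/mapP; exists (circ th) => //=.
  by rewrite cosK// in_itv/= th0.
apply/mapP; exists (circ th) => //=.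
by rewrite cosKN ?opprK// th1 ltW.
Qed.

(** Where [dd] vanishes on the circle so does [n], and the quotient takes the default value 0
    instead of the limit; only finitely many angles are affected. *)
Lemma h2sqE (n dd n' d' : {poly R}) : dd != 0 -> n * d' = n' * dd ->
  (forall th, (toC d').[circ th] != 0) ->
  h2sq n dd = (2 * pi)^-1 * circle_int (sqratio n' d').
Proof.
move=> dd0 nd d'0; rewrite /h2sq; congr (_ * _).
have [N NP] := finite_circle_roots dd0.
apply: (@Rintegral_eq_off_seq _ _ _ N) => //.
  apply: measurable_funTS; apply: continuous_measurable_fun.
  exact: continuous_sqratio.
move=> th /=; rewrite in_itv/= => thpi thN.
have ddth := NP th thpi thN.
rewrite /tf_circle -/(circ th) sqnormM sqnormV /sqratio.
have E : sqnorm (toC n).[circ th] * sqnorm (toC d').[circ th] =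
    sqnorm (toC n').[circ th] * sqnorm (toC dd).[circ th].
  by rewrite -!sqnormM -!hornerM -!toCM nd.
by apply/eqP; rewrite eqr_div ?sqnorm_eq0// E.
Qed.

Lemma circV (th : R) : (circ th)^-1 = Complex (cos th) (sin th).
Proof.
have c0 : circ th != 0 by rewrite -sqnorm_eq0 sqnorm_circ oner_eq0.
apply: (mulfI c0); rewrite mulfV//; apply/eqP; rewrite eq_complex ReM ImM /=.
have := cos2Dsin2 th; rewrite !expr2 mulNr opprK => ->.
by rewrite eqxx /=; apply/eqP; ring.
Qed.

Lemma conj_toC_circ (q : {poly R}) th :
  (toC q).[(circ th)^-1] = Complex (complex.Re (toC q).[circ th]) (- complex.Im (toC q).[circ th]).
Proof.
rewrite circV; elim/poly_ind: q => [|q c ih].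
  by rewrite /toC rmorph0 !horner0 /= oppr0.
rewrite !horner_toC_mulX ih; apply/eqP; rewrite eq_complex !ReD !ImD !ReM !ImM /=.
by apply/andP; split; apply/eqP; ring.
Qed.

Lemma mul_conj_circ (q : {poly R}) th :
  (toC q).[circ th] * (toC q).[(circ th)^-1] = (sqnorm (toC q).[circ th])%:C.
Proof.
rewrite conj_toC_circ /sqnorm; apply/eqP; rewrite eq_complex ReM ImM /=.
by apply/andP; split; apply/eqP; ring.
Qed.

End HtwoNorm.

(** Variance as half the mean squared difference of two independent copies, which explains the
    factor 1/2 in the equation for Phi. *)
Lemma sum_pair_sqr_dist (R : numFieldType) (n : nat) (p a : nat -> R) :
  \sum_(i < n) p i = 1 ->
  2^-1 * \sum_(i < n) \sum_(j < n) (a i - a j) ^+ 2 * (p i * p j) =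
  \sum_(t < n) p t * (a t - \sum_(i < n) p i * a i) ^+ 2.
Proof.
move=> p1; set A := \sum_(i < n) p i * a i; pose M := \sum_(i < n) p i * a i ^+ 2.
have -> : \sum_(i < n) \sum_(j < n) (a i - a j) ^+ 2 * (p i * p j) =
    2 * (M - A ^+ 2).
  rewrite (eq_bigr (fun i : 'I_n => p i * a i ^+ 2 + (- 2 * A) * (p i * a i) + M * p i)).
    by rewrite !big_split /= -!mulr_sumr p1 -/A -/M; ring.
  move=> i _; rewrite (eq_bigr (fun j : 'I_n => (p i * a i ^+ 2) * p j +
    (- 2 * (p i * a i)) * (p j * a j) + p i * (p j * a j ^+ 2))).
    by rewrite !big_split /= -!mulr_sumr p1 -/A -/M; ring.
  by move=> j _; ring.
rewrite mulKf ?pnatr_eq0//.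
rewrite (eq_bigr (fun t : 'I_n => p t * a t ^+ 2 + (- 2 * A) * (p t * a t) + A ^+ 2 * p t)).
  by rewrite !big_split /= -!mulr_sumr p1 -/A -/M; ring.
by move=> t _; ring.
Qed.

(** * The spectral factor on the unit circle *)

Section SpectralFactor.
Variables (R : realType) (tau : nat) (alpha p : nat -> R) (Phi : {poly R}).
Local Open Scope complex_scope.
Hypothesis p1 : \sum_(t < tau.+1) p t = 1.
Hypothesis PhiP : spectral_factor tau alpha p Phi.

Let horner_chan_dev t (th : R) : (toC (chan_dev tau alpha p t)).[circ th] =
  Complex (alpha t * cos (t%:R * th) - \sum_(i < tau.+1) p i * (alpha i * cos (i%:R * th)))
          (alpha t * - sin (t%:R * th) - \sum_(i < tau.+1) p i * (alpha i * - sin (i%:R * th))).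
Proof.
have -> : toC (chan_dev tau alpha p t) = ((alpha t)%:C)%:P * 'X^t -
    \poly_(i < tau.+1) (alpha i * p i)%:C.
  rewrite /toC rmorphB rmorphM /= map_polyC map_polyXn; congr (_ - _).
  by apply/polyP => i; rewrite coef_map /= !coef_poly; case: ifP.
rewrite hornerD hornerN hornerCM hornerXn horner_poly circX.
apply/eqP; rewrite eq_complex ReD ImD ReM ImM /=.
have ReN (z : R[i]) : complex.Re (- z) = - complex.Re z by case: z.
have ImN (z : R[i]) : complex.Im (- z) = - complex.Im z by case: z.
rewrite ReN ImN (big_morph _ (@ReD R) erefl) (big_morph _ (@ImD R) erefl).
apply/andP; split; apply/eqP; (congr (_ - _); first ring).
  by apply: eq_bigr => i _; rewrite circX ReM /=; ring.
by apply: eq_bigr => i _; rewrite circX ImM /=; ring.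
Qed.

(* Variance of the random gain [alpha_t z^-t], expanded around its mean [H]. *)
Lemma spectral_factor_circ th : sqnorm (toC Phi).[circ th] =
  \sum_(t < tau.+1) p t * sqnorm (toC (chan_dev tau alpha p t)).[circ th].
Proof.
have c0 : circ th != 0 by rewrite -sqnorm_eq0 sqnorm_circ oner_eq0.
pose a i := alpha i * cos (i%:R * th); pose b i := alpha i * - sin (i%:R * th).
rewrite (eq_bigr (fun t : 'I_tau.+1 => p t * (a t - \sum_(i < tau.+1) p i * a i) ^+ 2 +
    p t * (b t - \sum_(i < tau.+1) p i * b i) ^+ 2)); last first.
  by move=> t _; rewrite horner_chan_dev /sqnorm /= mulrDr.
rewrite big_split /= -!sum_pair_sqr_dist// -mulrDr -big_split /=.
case: PhiP => _ [_ /(_ _ c0)]; rewrite mul_conj_circ => E.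
apply: (@complexI R); rewrite [LHS]E rmorphM fmorphV rmorph_nat; congr (_ * _).
rewrite rmorph_sum; apply: eq_bigr => i _.
rewrite -big_split rmorph_sum; apply: eq_bigr => j _.
have cV x : (Complex (cos x) (- sin x) : R[i])^-1 = Complex (cos x) (sin x) := circV x.
rewrite !circX !cV; apply/eqP; rewrite eq_complex /=.
by apply/andP; split; apply/eqP; rewrite /a /b; ring.
Qed.

(* If the delay is deterministic the right-hand side of the factorization
   vanishes, whereas a minimum-phase [Phi] has no zero outside the disc. *)
Lemma spectral_factor_random : (forall t, 0 <= p t) ->
  exists2 t, (t <= tau)%N & 0 < p t * (1 - p t).
Proof.
move=> p0; apply: contrapT => np.
have p01 (t : 'I_tau.+1) : p t = 0 \/ p t = 1.
  have pt1 : p t <= 1 by rewrite -p1 (bigD1 t)//= lerDl sumr_ge0.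
  have := p0 t; rewrite le_eqVlt => /predU1P[<-|pt0]; first by left.
  move: pt1; rewrite le_eqVlt => /predU1P[->|pt1]; first by right.
  exfalso; apply: np; exists t; first by rewrite -ltnS.
  by rewrite mulr_gt0// subr_gt0.
have pp (i j : 'I_tau.+1) : i != j -> p i * p j = 0.
  move=> ij; case: (p01 i) => pi; first by rewrite pi mul0r.
  case: (p01 j) => pj; first by rewrite pj mulr0.
  have : p i + p j <= 1.
    rewrite -p1 (bigD1 i)//= lerD2l (bigD1 j) 1?eq_sym//= lerDl.
    exact: sumr_ge0.
  by rewrite pi pj; lra.
have [sPhi [mPhi PhiE]] := PhiP.
have Phi_root (z : R[i]) : 1 < sqnorm z -> (toC Phi).[z] = 0.
  move=> z1; have z0 : z != 0.
    by rewrite -sqnorm_eq0 gt_eqF// (lt_trans ltr01).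
  apply/eqP; have /eqP := PhiE z z0.
  rewrite big1 ?mulr0 ?mulf_eq0 ?(negbTE (mPhi z z0 z1)) ?orbF// => i _.
  rewrite big1// => j _; have [->|ij] := eqVneq i j; first by rewrite subrr !mul0r.
  by rewrite -mulrA -[X in _ * X]rmorphM pp// rmorph0 mulr0.
have Phi0 : toC Phi != 0 by rewrite map_poly_eq0 -size_poly_gt0 sPhi.
(* The points 2, ..., tau + 2 lie outside the closed disc: one root more than the degree tau
   allows. *)
pose rs := [seq (k.+2)%:R%:C : R[i] | k <- iota 0 tau.+1].
have /max_poly_roots : toC Phi != 0 by [].
move=> /(_ rs); rewrite size_map size_iota size_map_poly sPhi ltnn => H.
suff : false by []. apply: H.
  apply/allP => _ /mapP[k _ ->]; rewrite rootE; apply/eqP/Phi_root.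
  by rewrite /sqnorm /= expr0n addr0 -natrX ltr1n.
rewrite map_inj_uniq ?iota_uniq// => i j /complexI /eqP.
by rewrite eqr_nat => /eqP [].
Qed.

End SpectralFactor.

(** * The sums of g^2 and s as squared norms *)

Section LoopVariance.
Variable R : realType.

Lemma circle_int_sum n (a : nat -> R) (f : nat -> R -> R) :
  (forall i, continuous (f i)) ->
  circle_int (fun th => \sum_(i < n) a i * f i th) =
  \sum_(i < n) a i * circle_int (f i).
Proof.
move=> cf; elim: n => [|n ih].
  by under eq_fun do rewrite big_ord0; rewrite circle_int_cst mul0r big_ord0.
under eq_fun do rewrite big_ord_recr /=.
have caf i : continuous (fun th => a i * f i th).
  by move=> t; apply: cvgM; [exact: cvg_cst|exact: cf].
rewrite circle_intD//; first by rewrite ih circle_intZ// big_ord_recr.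
elim: n {ih} => [|n ih].
  by under eq_fun do rewrite big_ord0; exact: cst_continuous.
under eq_fun do rewrite big_ord_recr /=.
by move=> t; apply: cvgD; [exact: ih|exact: caf].
Qed.

Lemma conv1_sqr_cvg0 (g : nat -> R) (A : R) :
  conv (fun i => g i ^+ 2) (fun=> 1) @ \oo --> A -> g @ \oo --> (0 : R).
Proof.
move=> gA; apply/cvgrPdist_le => eps eps0.
have e20 : 0 < eps ^+ 2 / 2 by rewrite divr_gt0// exprn_gt0.
have /cvgrPdist_le/(_ _ e20) [N _ HN] := gA.
exists N.+1 => // -[//|k] /= Nk; rewrite sub0r normrN.
have h1 := HN k Nk; have h2 := HN k.+1 (leqW Nk).
rewrite -(@ler_sqr _ `|g k.+1|) ?nnegrE ?(ltW eps0)// real_normK ?num_real//.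
have -> : g k.+1 ^+ 2 = conv (fun i => g i ^+ 2) (fun=> 1) k.+1 -
    conv (fun i => g i ^+ 2) (fun=> 1) k.
  by rewrite !conv1E [in RHS]big_ord_recr /= addrAC subrr add0r.
move: h1 h2 => /=; move: (conv _ _ k) (conv _ _ k.+1) => x y.
by rewrite !ler_norml => /andP[? ?] /andP[? ?]; lra.
Qed.

Lemma cvg0_conv_coefs (g : nat -> R) (q : {poly R}) : g @ \oo --> (0 : R) ->
  conv g (coefs q) @ \oo --> (0 : R).
Proof.
move=> g0; pose f i := `|coefs q i|.
have f0 i : 0 <= f i by exact: normr_ge0.
have [k|F fF] := @conv1_bounded_cvg _ f (\sum_(i < size q) f i) f0.
  rewrite -(@sum_delayed_conv _ (size q)); last first.
    by move=> i qi; rewrite /f /coefs nth_default// normr0.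
  rewrite -(big_mkord xpredT f); apply: ler_sum => i _.
  by case: ifP => _; rewrite ?mulr1 ?mulr0.
have gn : (fun k => `|g k|) @ \oo --> (0 : R) by rewrite -(normr0 R); exact: cvg_norm.
have := cvg_conv f0 fF gn; rewrite mulr0 => H.
apply/norm_cvg0P; apply: (squeeze_cvgr _ (cvg_cst 0) H).
apply: nearW => k; rewrite normr_ge0 /= convC.
apply: le_trans (ler_norm_sum _ _ _) _.
by apply: ler_sum => i _; rewrite normrM.
Qed.

End LoopVariance.

Definition loop_dev_var (R : realType) (tau : nat) (alpha p g : nat -> R) (m : nat) : R :=
  \sum_(t < tau.+1) p t * conv g (coefs (chan_dev tau alpha p t)) m ^+ 2.

Section LoopLimit.
Variables (R : realType) (tau : nat) (alpha p : nat -> R).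
Variables (bP aP bK aK Phi : {poly R}).
Hypotheses (p_ge0 : forall i, 0 <= p i) (p1 : \sum_(i < tau.+1) p i = 1).
Hypotheses (bP0 : bP`_0 = 0) (aP0 : aP`_0 = 1) (aK0 : aK`_0 = 1).
Hypothesis PhiP : spectral_factor tau alpha p Phi.

Let num := G_num bP bK.
Let den := G_den tau alpha p bP aP bK aK.
Let D := chan_dev tau alpha p.

Variables (n' d' : {poly R}).
Hypothesis nd : num * d' = n' * den.
Hypothesis d'_neq0 : forall w : R[i], sqnorm w <= 1 -> (toC d').[w] != 0.

Variable g : nat -> R.
Hypothesis gE : conv (coefs den) g = coefs num.

Let c t := conv g (coefs (D t)).
Let s := loop_dev_var tau alpha p g.

Let den0 : (coefs den) 0%N = 1.
Proof. exact: G_den0. Qed.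

Let den_neq0 : den != 0.
Proof.
by apply/eqP => den0'; have := den0; rewrite den0' /coefs coef0 => /esym/eqP; rewrite oner_eq0.
Qed.

Let d'_circ th : (toC d').[circ th] != 0.
Proof. by apply: d'_neq0; rewrite sqnorm_circ. Qed.

(** Cancelling common factors leaves the impulse response unchanged, so Parseval can be applied with
    the denominator [d'], which has no zero on the circle. *)
Let d'g : conv (coefs d') g = coefs n'.
Proof.
apply: (conv_cancel den0).
rewrite convA (convC (coefs den) (coefs d')) -convA gE !conv_coefs.
by rewrite mulrC nd mulrC.
Qed.

Lemma loop_dev_mean m : \sum_(t < tau.+1) p t * c t m = 0.
Proof.
rewrite (eq_bigr (fun t : 'I_tau.+1 => conv g (fun i => p t * coefs (D t) i) m)); last first.
  by move=> t _; rewrite convZr.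
have := congr1 (fun h => h m) (conv_sumr (index_enum 'I_tau.+1) g (fun t i => p t * coefs (D t) i)).
move=> /= <-; rewrite /conv big1// => i _.
by rewrite /coefs sum_chan_dev ?mulr0.
Qed.

Let g0 : g 0%N = 0.
Proof. exact: (response0 bP0 aP0 aK0 gE). Qed.

Lemma loop_dev_var0 : s 0%N = 0.
Proof.
by rewrite /s /loop_dev_var big1// => t _; rewrite /c /conv big_ord1 g0 mul0r expr0n mulr0.
Qed.

Lemma loop_dev_var_ge0 m : 0 <= s m.
Proof. by apply: sumr_ge0 => t _; rewrite mulr_ge0// sqr_ge0. Qed.

Hypothesis g_cvg0 : g @ \oo --> (0 : R).

Lemma response_h2 : conv (fun i => g i ^+ 2) (fun=> 1) @ \oo --> h2sq num den.
Proof. by rewrite (h2sqE den_neq0 nd d'_circ); exact: parseval. Qed.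

Lemma loop_dev_h2 :
  conv s (fun=> 1) @ \oo --> h2sq (Phi * num) den.
Proof.
have nd' : Phi * num * d' = (Phi * n') * den by rewrite -mulrA nd mulrA.
rewrite (h2sqE den_neq0 nd' d'_circ).
have -> : circle_int (sqratio (Phi * n') d') =
    \sum_(t < tau.+1) p t * circle_int (sqratio (D t * n') d').
  rewrite -(@circle_int_sum R tau.+1 p (fun t => sqratio (D t * n') d')); last first.
    by move=> i; exact: continuous_sqratio.
  congr circle_int; apply/funext => th.
  rewrite /sqratio toCM hornerM sqnormM (spectral_factor_circ p1 PhiP).
  rewrite -mulrA mulr_suml; apply: eq_bigr => t _.
  by rewrite toCM hornerM sqnormM !mulrA.
have -> : conv s (fun=> 1) = fun k => \sum_(t < tau.+1) p t * conv (fun i => c t i ^+ 2) (fun=> 1) k.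
  rewrite convC conv_sumr; apply/funext => k; apply: eq_bigr => t _.
  by rewrite convZr convC.
rewrite mulr_sumr (eq_bigr (fun t : 'I_tau.+1 => p t *
  ((2 * pi)^-1 * circle_int (sqratio (D t * n') d')))); last by move=> t _; rewrite mulrCA.
apply: cvg_big => [|t _]; first exact: add_continuous.
apply: cvgM; first exact: cvg_cst.
apply: parseval => //; last exact: cvg0_conv_coefs.
by rewrite convA d'g conv_coefs mulrC.
Qed.

End LoopLimit.

(** * Second moment of the loop and its limit *)

Section LoopSecondMoment.
Context {R : realType} {d : measure_display} {T : measurableType d}.
Variables (P : probability T R) (tau : nat) (alpha p : nat -> R).
Variables (bP aP bK aK : {poly R}).
Hypothesis p1 : \sum_(i < tau.+1) p i = 1.
Hypotheses (bP0 : bP`_0 = 0) (aP0 : aP`_0 = 1) (aK0 : aK`_0 = 1).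
Variables (del : nat -> T -> nat) (v : nat -> T -> R) (sv : nat -> R).
Hypothesis delP : delay_process P tau p del.
Hypothesis v_indep : mutual_indep P (fun k => events_real (v k)).
Hypothesis v_del : indep_families P (fun k => events_real (v k)) (fun n => events_nat (del n)).
Hypothesis v_mean : forall k, has_mean P (v k) 0.
Hypothesis v_var : forall k, has_mean P (fun w => v k w ^+ 2) (sv k).
Variables (g r : nat -> R).
Hypothesis gE : conv (coefs (G_den tau alpha p bP aP bK aK)) g = coefs (G_num bP bK).
Hypothesis rr : renewal (loop_dev_var tau alpha p g) r.

(** Applied twice, to the test noise over the even delays and to the given input: g and r depend on
    the law p only, so both uses share them. *)
Lemma loop_second_moment k :
  has_mean P (fun w => cl_u bP aP bK aK tau alpha (v ^~ w) (del ^~ w) k ^+ 2)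
             (conv r (conv (fun i => g i ^+ 2) sv) k).
Proof.
have del_le n w : (del n w <= tau)%N by case: delP.
pose U w := cl_u bP aP bK aK tau alpha (v ^~ w) (del ^~ w).
pose c t := conv g (coefs (chan_dev tau alpha p t)).
have UE w i : U w i = conv g (v ^~ w) i - \sum_(n < i) c (del n w) (i - n)%N * U w n.
  exact: (loop_recursion (p := p)).
have [x [hx xE]] := second_moment_recursion p1 delP v_indep v_del v_mean v_var
  (loop_dev_mean alpha p1 g) UE.
have s0 := loop_dev_var0 bP0 aP0 aK0 gE.
rewrite -(renewal_solution (x := x) s0 rr); first exact: hx.
by move=> i; rewrite xE [conv _ x i]conv_rev big_ord_recr /= subnn s0 mul0r addr0.
Qed.

End LoopSecondMoment.

Theorem theorem3 (R : realType) (tau : nat) (alpha p : nat -> R)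
    (bP aP bK aK Phi : {poly R})
    (d : measure_display) (T : measurableType d) (P : probability T R)
    (del : nat -> T -> nat) (v : nat -> T -> R) (sv : nat -> R) (sv_inf : R) :
  (forall i, 0 <= p i) -> \sum_(i < tau.+1) p i = 1 ->
  bP`_0 = 0 -> aP`_0 = 1 -> aK`_0 = 1 ->
  spectral_factor tau alpha p Phi ->
  ms_stable tau alpha p bP aP bK aK ->
  delay_process P tau p del ->
  (forall k, measurable_fun setT (v k)) ->
  mutual_indep P (fun k => events_real (v k)) ->
  indep_families P (fun k => events_real (v k)) (fun n => events_nat (del n)) ->
  (forall k, P.-integrable setT (EFin \o v k)) ->
  (forall k, (\int[P]_w (v k w)%:E = 0)%E) ->
  (forall k, (\int[P]_w ((v k w) ^+ 2)%:E = (sv k)%:E)%E) ->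
  (exists M : R, forall k, sv k <= M) ->
  sv n @[n --> \oo] --> sv_inf ->
  (\int[P]_w ((cl_u bP aP bK aK tau alpha (fun j => v j w) (fun n => del n w) k) ^+ 2)%:E)%E
    @[k --> \oo] -->
  ((h2sq (G_num bP bK) (G_den tau alpha p bP aP bK aK)
    / (1 - h2sq (Phi * G_num bP bK) (G_den tau alpha p bP aP bK aK))) * sv_inf)%:E.
Proof.
move=> p_ge0 p1 bP0 aP0 aK0 PhiP [[n' [d' [nd d'_neq0]]] test] delP mv v_indep v_del
  v_int v_mean v_var _ sv_cvg.
have hv k : has_mean P (v k) 0 by [].
have hv2 k : has_mean P (fun w => v k w ^+ 2) (sv k).
  split => //; apply/integrableP; split.
    by apply/measurable_EFinP; apply: measurable_funX.
  rewrite (eq_integral (fun w => (v k w ^+ 2)%:E)) ?v_var ?ltry// => w _.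
  by rewrite /= ger0_norm// sqr_ge0.
have [|g gE] := @conv_solve _ (coefs (G_den tau alpha p bP aP bK aK)) (coefs (G_num bP bK)).
  exact: G_den0.
pose s := loop_dev_var tau alpha p g.
have s0 : s 0%N = 0 := loop_dev_var0 bP0 aP0 aK0 gE.
have s_ge0 m : 0 <= s m by exact: loop_dev_var_ge0.
have [r rr] := exists_renewal s0.
pose g2 i := g i ^+ 2.
have g2_ge0 i : 0 <= g2 i by exact: sqr_ge0.
have [t tle q_gt0] := spectral_factor_random p1 PhiP p_ge0.
have [M HM] := test _ _ P _ _ (delay_process_even delP) (white_delay_noise delP tle)
  (@delay_noise_even _ _ _ _ _ _ _ delP t).
have test_bound k : conv r (conv g2 (fun=> p t * (1 - p t))) k <= M.
  have [_ E] := loop_second_moment p1 bP0 aP0 aK0 (delay_process_even delP)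
    (@delay_noise_indep _ _ _ _ _ _ _ delP t) (@delay_noise_even _ _ _ _ _ _ _ delP t)
    (fun k => has_mean_delay_noise delP k tle) (fun k => has_mean_delay_noise_sq delP k tle) gE rr k.
  by have [_] := HM k; rewrite E lee_fin.
have [[A gA] Rs_ex] := bounded_response_sums s_ge0 s0 rr q_gt0 g2_ge0 test_bound.
have g_cvg0 := conv1_sqr_cvg0 gA.
have [Rs rRs] : exists Rs : R, conv r (fun=> 1) @ \oo --> Rs.
  (* When g = 0 the test carries no information on r; but then s = 0, r is the unit pulse and its
     sum is 1. *)
  have [g_neq0|g_eq0] := pselect (exists j, g2 j != 0); first exact: Rs_ex.
  have g00 j : g j = 0.
    apply/eqP; rewrite -sqrf_eq0; apply: contrapT => /negP gj.
    by apply: g_eq0; exists j.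
  have conv0l (f h : nat -> R) k : (forall i, f i = 0) -> conv f h k = 0.
    by move=> f0; rewrite /conv big1// => i _; rewrite f0 mul0r.
  have s00 m : s m = 0.
    by rewrite /s /loop_dev_var big1// => i _; rewrite conv0l// expr0n mulr0.
  exists 1; rewrite (_ : conv r (fun=> 1) = fun=> 1); first exact: cvg_cst.
  apply/funext => k; rewrite (_ : r = unit_pulse 0) ?conv_unitl//.
  by rewrite rr; apply/funext => i; rewrite conv0l// addr0.
have [S [sS RsS]] := renewal_sum s_ge0 s0 rr rRs.
have gh2 := response_h2 bP0 aP0 aK0 nd d'_neq0 gE g_cvg0.
have sh2 := loop_dev_h2 p1 bP0 aP0 aK0 PhiP nd d'_neq0 gE g_cvg0.
set h := h2sq (G_num bP bK) _ in gh2 *.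
set hPhi := h2sq (Phi * _) _ in sh2 *.
have SE : S = hPhi by exact: (cvg_unique _ sS sh2).
have RsE : Rs = (1 - hPhi)^-1.
  have S1 : 1 - S != 0.
    by apply/eqP => S1; move: RsS; rewrite S1 mulr0 => /esym/eqP; rewrite oner_eq0.
  by rewrite -SE; apply: (mulIf S1); rewrite RsS mulVf.
rewrite (_ : (fun k => _) = EFin \o conv r (conv g2 sv)); last first.
  apply/funext => k /=.
  by have [_ ->] := loop_second_moment p1 bP0 aP0 aK0 delP v_indep v_del hv hv2 gE rr k.
apply: cvg_EFin; first by apply: nearW.
(* Convolution with g^2 multiplies the limit by [h], and convolution with r by [Rs]. *)
rewrite (_ : h / (1 - hPhi) * sv_inf = Rs * (h * sv_inf)); last by rewrite RsE; ring.
apply: cvg_conv rRs _; first exact: (renewal_ge0 s_ge0 s0 rr).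
exact: cvg_conv.
Qed.
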